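(* Let $(E,g,\rho,[\,,\,])$ be a pre-Courant algebroid over a manifold $M$. Then, for any pseudo-Euclidean vector bundle $(C,g_0)$ over $M$ and any metric connection $\nabla$ on $C$, the brackets $$[e_1,e_2],\qquad [e,c]=-[c,e]=\nabla_{\rho e}c,\qquad [c_1,c_2]=-\gamma_0(c_1,c_2),$$ where $e,e_1,e_2\in\Gamma E$, $c,c_1,c_2\in\Gamma C$, $[e_1,e_2]$ is the given bracket of $E$, and $\gamma_0(c_1,c_2)\in\Gamma E$ is defined by $$g(\gamma_0(c_1,c_2),e)=\tfrac12\left[g_0(c_1,\nabla_{\rho e}c_2)-g_0(c_2,\nabla_{\rho e}c_1)\right]\qquad\forall e\in\Gamma E,$$ define a pre-Courant algebroid structure on $(E\oplus C,\,g\oplus g_0,\,\rho\oplus0)$. If the original algebroid $E$ is a Courant algebroid, these brackets yield a Courant algebroid structure if and only if the connection $\nabla$ is flat.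
   Context: Everything is $C^\infty$; $\Gamma$ denotes the space of global cross sections; brackets are $\mathbb{R}$-bilinear. A pseudo-Euclidean vector bundle is a real vector bundle with a symmetric, non-degenerate (possibly indefinite) fiber inner product. A connection on it is metric if it preserves the inner product. For a morphism $\rho:E\to TM$ on a pseudo-Euclidean bundle $(E,g)$, $\partial:T^*M\to E$ is $\partial=\frac12\sharp_g\circ{}^t\rho$ (${}^t\rho$ the transpose, $\sharp_g:E^*\to E$ the isomorphism induced by $g$) and $\partial f=\partial(df)$, i.e. $g(\partial f,e)=\frac12(\rho e)f$ for $f\in C^\infty(M)$, $e\in\Gamma E$. A Courant vector bundle is a triple $(E,g,\rho)$ where $(E,g)$ is a pseudo-Euclidean vector bundle over $M$ and $\rho:E\to TM$ is a vector bundle morphism such that $\mathrm{im}\,\rho$ is a (generalized) foliation of $M$ and $\mathrm{im}\,\partial$ is $g$-isotropic (equivalently $\rho\circ\partial=0$). A pre-Courant algebroid is a Courant vector bundle with a skew-symmetric bracket $[\,,\,]$ on $\Gamma E$ such that for all $e,e_1,e_2\in\Gamma E$: (i) $\rho[e_1,e_2]=[\rho e_1,\rho e_2]$; (v) $(\rho e)(g(e_1,e_2))=g([e,e_1]+\partial g(e,e_1),e_2)+g(e_1,[e,e_2]+\partial g(e,e_2))$; these imply (ii) $\rho\circ\partial=0$ and (iv) $[e_1,fe_2]=f[e_1,e_2]+((\rho e_1)f)e_2-g(e_1,e_2)\partial f$ for $f\in C^\infty(M)$. It is a (skew-symmetric) Courant algebroid if moreover (iii) $\sum_{Cycl}[[e_1,e_2],e_3]=\frac13\partial\big[\sum_{Cycl}g([e_1,e_2],e_3)\big]$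 for all $e_1,e_2,e_3\in\Gamma E$ (cyclic sums over $(1,2,3)$).
   Formalization: ''Only if ∇ is flat'' fails when ρ is not onto (e.g. E = 0, ∇ non-flat); proved instead, for E Courant: ∇ flat implies Courant, Courant iff the curvature R(X,Y) vanishes for X,Y in ρ(ΓE), and Courant iff ∇ flat when ρ: ΓE → ΓTM is onto. *)

(* Defs.v *)
From HB Require Import structures.
From mathcomp Require Import all_boot all_order all_algebra ring.
From mathcomp Require Import all_classical all_reals.
From mathcomp Require Import topology normedtype derive.

Set Implicit Arguments.
Unset Strict Implicit.
Unset Printing Implicit Defensive.

Import Order.TTheory GRing.Theory Num.Theory.
Import numFieldNormedType.Exports.

Local Open Scope classical_set_scope.
Local Open Scope ring_scope.

Section EuclideanSmoothness.
Context {R : realType} {n : nat}.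
Implicit Types (U V : set 'rV[R]_n) (f g : 'rV[R]_n -> R).

(* All iterated partial derivatives of order at most k exist and are continuous
   at the points of U; only meaningful for open U. *)
Fixpoint Ck (k : nat) U f : Prop :=
  (forall y, U y -> {for y, continuous f}) /\
  if k is k'.+1 then
    forall i : 'I_n, (forall y, U y -> derivable f y (delta_mx 0 i)) /\
                     Ck k' U (fun y => 'D_(delta_mx 0 i) f y)
  else True.

Definition Cinfty U f : Prop := forall k, Ck k U f.

Lemma Ck_cont k U f : Ck k U f -> forall y, U y -> {for y, continuous f}.
Proof. by case: k => [|k] []. Qed.

Lemma Ck_pred k U f : Ck k.+1 U f -> Ck k U f.
Proof.
elim: k f => [|k IH] f [cf df]; first by split.
by split=> // i; have [? ?] := df i; split => //; exact: IH.
Qed.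

Lemma Ck_local k U f :
  (forall y, U y -> exists2 V, V y & Ck k V f) -> Ck k U f.
Proof.
elim: k f => [|k IH] f H.
  by split=> // y /H[V Vy /Ck_cont cV]; exact: cV.
split; first by move=> y /H[V Vy /Ck_cont cV]; exact: cV.
move=> i; split; first by move=> y /H[V Vy [_ /(_ i)[dV _]]]; exact: dV.
by apply: IH => y /H[V Vy [_ /(_ i)[_ ?]]]; exists V.
Qed.

Lemma Ck_sub k U V f : U `<=` V -> Ck k V f -> Ck k U f.
Proof. by move=> UV fV; apply: Ck_local => y /UV Vy; exists V. Qed.

Lemma Ck_ext k U f g : open U -> (forall y, U y -> f y = g y) ->
  Ck k U f -> Ck k U g.
Proof.
move=> oU; elim: k f g => [|k IH] f g fg.
  move=> [cf _]; split=> // y Uy.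
  have nfg : \forall z \near y, f z = g z.
    by apply: filterS (open_nbhs_nbhs (conj oU Uy)) => z /fg.
  rewrite /continuous_at /prop_for -(fg _ Uy).
  by apply: cvg_trans (near_eq_cvg nfg) _; exact: cf.
move=> [cf df].
have nfg y : U y -> \forall z \near y, f z = g z.
  by move=> Uy; apply: filterS (open_nbhs_nbhs (conj oU Uy)) => z /fg.
split.
  move=> y Uy; rewrite /continuous_at /prop_for -(fg _ Uy).
  by apply: cvg_trans (near_eq_cvg (nfg _ Uy)) _; exact: cf.
move=> i; have [dfi kfi] := df i; split.
  by move=> y Uy; apply: near_eq_derivable (nfg _ Uy) (dfi _ Uy).
apply: IH kfi => y Uy; exact: near_eq_derive (nfg _ Uy).
Qed.

Lemma Ck_cst k U (a : R) : Ck k U (fun=> a).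
Proof.
elim: k a => [|k IH] a; first by split=> // y _; exact: cst_continuous.
split=> [y _|i]; first exact: cst_continuous.
split=> [y _|]; first exact: derivable_cst.
suff -> : (fun y => 'D_(delta_mx 0 i) (fun=> a) y) = (fun=> 0) :> ('rV[R]_n -> R).
  exact: IH.
by apply/funext => y; exact: derive_cst.
Qed.

Lemma CkD k U f g : open U -> Ck k U f -> Ck k U g ->
  Ck k U (fun y => f y + g y).
Proof.
move=> oU; elim: k f g => [|k IH] f g [cf df] [cg dg].
  by split=> // y Uy; apply: continuousD; [exact: cf|exact: cg].
split=> [y Uy|i]; first by apply: continuousD; [exact: cf|exact: cg].
have [dfi kfi] := df i; have [dgi kgi] := dg i; split=> [y Uy|].
  by apply: derivableD; [exact: dfi|exact: dgi].
apply: Ck_ext (IH _ _ kfi kgi) => // y Uy.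
by rewrite -[RHS]/('D_(delta_mx 0 i) (f + g) y) deriveD //;
  [exact: dfi|exact: dgi].
Qed.

Lemma CkM k U f g : open U -> Ck k U f -> Ck k U g ->
  Ck k U (fun y => f y * g y).
Proof.
move=> oU; elim: k f g => [|k IH] f g kf kg.
  case: kf kg => [cf _] [cg _].
  by split=> // y Uy; apply: continuousM; [exact: cf|exact: cg].
have pf := Ck_pred kf; have pg := Ck_pred kg.
case: kf kg => [cf df] [cg dg].
split=> [y Uy|i]; first by apply: continuousM; [exact: cf|exact: cg].
have [dfi kfi] := df i; have [dgi kgi] := dg i; split=> [y Uy|].
  by apply: derivableM; [exact: dfi|exact: dgi].
apply: Ck_ext (CkD oU (IH _ _ pf kgi) (IH _ _ pg kfi)) => // y Uy.
by rewrite -[RHS]/('D_(delta_mx 0 i) (f * g) y) deriveM //;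
  [exact: dfi|exact: dgi].
Qed.

End EuclideanSmoothness.

Section Manifolds.
Context (R : realType).

Record chart (n : nat) (T : topologicalType) := Chart {
  chart_dom : set T;
  chart_to :> T -> 'rV[R]_n;
  chart_from : 'rV[R]_n -> T;
  chart_dom_open : open chart_dom;
  chart_img_open : open (chart_to @` chart_dom);
  chart_toK : {in chart_dom, cancel chart_to chart_from};
  chart_to_cont : forall x, chart_dom x -> {for x, continuous chart_to};
  chart_from_cont :
    forall y, (chart_to @` chart_dom) y -> {for y, continuous chart_from} }.

Record manifold := Manifold {
  mcarrier :> topologicalType;
  mdim : nat;
  atlas : set (chart mdim mcarrier);
  manifold_hausdorff : hausdorff_space mcarrier;
  manifold_second_countable : @second_countable mcarrier;
  atlas_cover : forall x, exists2 c, atlas c & chart_dom c x;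
  atlas_compat : forall c c' (i : 'I_mdim), atlas c -> atlas c' ->
    Cinfty (c @` (chart_dom c `&` chart_dom c'))
           (fun y => c' (chart_from c y) 0 i) }.

End Manifolds.

Section SmoothFunctions.
Context (R : realType) (M : manifold R).
Implicit Types (U V : set M) (f g : M -> R).

Definition smooth_on U f : Prop := forall c, atlas c ->
  Cinfty (c @` (U `&` chart_dom c)) (f \o chart_from c).

Lemma chart_image_open (c : chart R (mdim M) M) U :
  open U -> open (c @` (U `&` chart_dom c)).
Proof.
move=> oU.
have -> : c @` (U `&` chart_dom c) =
    c @` chart_dom c `&` chart_from c @^-1` U.
  apply/seteqP; split => [y [x [Ux dx] <-]|y [[x dx <-]]].
    by split; [exists x|rewrite /= (chart_toK (mem_set dx))].
  by rewrite /= (chart_toK (mem_set dx)) => Ux; exists x.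
rewrite openE => y [cy Uy]; apply: filterI.
  by apply: open_nbhs_nbhs; split=> //; exact: chart_img_open.
by apply: (chart_from_cont cy); apply: open_nbhs_nbhs.
Qed.

Lemma smooth_on_cst U (a : R) : smooth_on U (fun=> a).
Proof. by move=> c _ k; exact: Ck_cst. Qed.

Lemma smooth_onD U f g : open U -> smooth_on U f -> smooth_on U g ->
  smooth_on U (fun x => f x + g x).
Proof.
move=> oU sf sg c ac k.
apply: (@CkD _ _ k _ (f \o chart_from c) (g \o chart_from c)).
- exact: chart_image_open.
- exact: sf.
- exact: sg.
Qed.

Lemma smooth_onM U f g : open U -> smooth_on U f -> smooth_on U g ->
  smooth_on U (fun x => f x * g x).
Proof.
move=> oU sf sg c ac k.
apply: (@CkM _ _ k _ (f \o chart_from c) (g \o chart_from c)).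
- exact: chart_image_open.
- exact: sf.
- exact: sg.
Qed.

Lemma smooth_on_sub U V f : U `<=` V -> smooth_on V f -> smooth_on U f.
Proof.
move=> UV sf c ac k; apply: Ck_sub (sf c ac k).
by apply: image_subset; exact: setSI.
Qed.

Lemma smooth_on_local U f :
  (forall x, U x -> exists2 V, V x & smooth_on V f) -> smooth_on U f.
Proof.
move=> H c ac k; apply: Ck_local => y [x [Ux dx] <-].
have [V Vx sV] := H _ Ux; exists (c @` (V `&` chart_dom c)); last exact: sV.
by exists x.
Qed.

Definition smooth_pred : {pred M -> R} := fun f => `[< smooth_on setT f >].

(* The algebra C^oo(M). *)
Record smoothfun := SmoothFun {
  smoothfun_val :> M -> R;
  smoothfun_subproof : smoothfun_val \in smooth_pred }.

HB.instance Definition _ := [isSub for smoothfun_val].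
HB.instance Definition _ := [Choice of smoothfun by <:].

Fact smooth_subring : subring_closed smooth_pred.
Proof.
split.
- by apply/asboolP; exact: smooth_on_cst.
- move=> f g /asboolP sf /asboolP sg; apply/asboolP.
  have -> : f - g = fun x => f x + -1 * g x.
    by apply/funext => x; rewrite mulN1r.
  apply: smooth_onD => //; first exact: openT.
  by apply: smooth_onM => //; [exact: openT|exact: smooth_on_cst].
- move=> f g /asboolP sf /asboolP sg; apply/asboolP.
  by apply: smooth_onM => //; exact: openT.
Qed.

HB.instance Definition _ := GRing.isSubringClosed.Build _ _ smooth_subring.
HB.instance Definition _ :=
  GRing.SubChoice_isSubComPzRing.Build _ _ smoothfun (subringClosedP _).

Lemma smoothfun_smooth (f : smoothfun) U : smooth_on U f.
Proof.
apply: (@smooth_on_sub _ setT) => //.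
by apply/asboolP; exact: smoothfun_subproof.
Qed.

Definition mk_smoothfun f (sf : smooth_on setT f) : smoothfun :=
  SmoothFun (asboolT sf).

Definition cst_smoothfun (a : R) : smoothfun :=
  mk_smoothfun (smooth_on_cst setT a).

Definition smoothfun_scale (a : R) (f : smoothfun) : smoothfun :=
  cst_smoothfun a * f.

Fact smoothfun_scaleA (a b : R) (f : smoothfun) :
  smoothfun_scale a (smoothfun_scale b f) = smoothfun_scale (a * b) f.
Proof. by apply/val_inj/funext => x; rewrite /= mulrA. Qed.
Fact smoothfun_scale1 : left_id 1 smoothfun_scale.
Proof. by move=> f; apply/val_inj/funext => x; exact: mul1r. Qed.
Fact smoothfun_scaleDr : right_distributive smoothfun_scale +%R.
Proof. by move=> a f g; rewrite /smoothfun_scale mulrDr. Qed.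
Fact smoothfun_scaleDl (f : smoothfun) :
  {morph smoothfun_scale^~ f : a b / a + b}.
Proof. by move=> a b; apply/val_inj/funext => x; exact: mulrDl. Qed.

HB.instance Definition _ := GRing.Zmodule_isLmodule.Build R smoothfun
  smoothfun_scaleA smoothfun_scale1 smoothfun_scaleDr smoothfun_scaleDl.

End SmoothFunctions.

Section TangentSpace.
Context (R : realType) (M : manifold R) (x : M).

Definition derivation_at : {pred smoothfun M -> R^o} := fun v =>
  `[< (forall (a : R) f h, v (a *: f + h) = a * v f + v h) /\
      (forall f h, v (f * h) = v f * h x + f x * v h) >].

(* T_x M, as the space of derivations at x of the algebra C^oo(M). *)
Record tangent := Tangent {
  tangent_val :> smoothfun M -> R^o;
  tangent_subproof : tangent_val \in derivation_at }.

HB.instance Definition _ := [isSub for tangent_val].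
HB.instance Definition _ := [Choice of tangent by <:].

Fact derivation_at_submod : submod_closed derivation_at.
Proof.
split.
  by apply/asboolP; split=> *; rewrite /= ?mulr0 ?mul0r addr0.
move=> a u v /asboolP[lu du] /asboolP[lv dv]; apply/asboolP.
have E f : (a *: u + v) f = a * u f + v f by [].
split=> [b f h|f h]; rewrite !E.
  by rewrite lu lv !mulrDr !mulrA (mulrC a b) addrACA.
by rewrite du dv !mulrDr !mulrDl addrACA !mulrA (mulrC a (f x)).
Qed.

HB.instance Definition _ :=
  GRing.isSubmodClosed.Build _ _ derivation_at derivation_at_submod.
HB.instance Definition _ := [SubChoice_isSubLmodule of tangent by <:].

Lemma tangentP (v : tangent) :
  (forall (a : R) f h, v (a *: f + h) = a * v f + v h) /\
  (forall f h, v (f * h) = v f * h x + f x * v h).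
Proof. by apply/asboolP; exact: tangent_subproof. Qed.

End TangentSpace.

(* A family of vector spaces over M with a notion of smooth local section;
   the common interface of vector bundles and of the tangent bundle.  Local
   sections on U are represented by global ones, with junk values outside U. *)
Record smooth_family (R : realType) (M : manifold R) := SmoothFamily {
  fib :> M -> lmodType R;
  smooth_sec : set M -> (forall x, fib x) -> Prop;
  smooth_sec0 : forall U, smooth_sec U (fun=> 0);
  smooth_secP : forall U (f : smoothfun M) s t, open U ->
    smooth_sec U s -> smooth_sec U t ->
    smooth_sec U (fun x => f x *: s x + t x) }.
Arguments smooth_sec {R M F} U s : rename.

Section Sections.
Context (R : realType) (M : manifold R) (F : smooth_family M).

Record Gamma := GammaSec {
  gamma_val :> forall x, F x;
  gamma_smooth : smooth_sec setT gamma_val }.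

HB.instance Definition _ := gen_eqMixin Gamma.
HB.instance Definition _ := gen_choiceMixin Gamma.

Lemma gammaP (s t : Gamma) : (forall x, s x = t x) -> s = t.
Proof.
case: s t => [s ss] [t st] /= st_eq.
have E : s = t by apply: functional_extensionality_dep.
by subst t; congr GammaSec; exact: Prop_irrelevance.
Qed.

Definition gamma_comb (f : smoothfun M) (s t : Gamma) : Gamma :=
  GammaSec (smooth_secP f openT (gamma_smooth s) (gamma_smooth t)).
Definition gamma_zero : Gamma := GammaSec (smooth_sec0 F setT).
Definition gamma_add (s t : Gamma) := gamma_comb 1 s t.
Definition gamma_opp (s : Gamma) := gamma_comb (-1) s gamma_zero.
Definition gamma_scale (f : smoothfun M) (s : Gamma) := gamma_comb f s gamma_zero.

Fact gamma_addE s t x : gamma_add s t x = s x + t x.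
Proof. exact: (congr1 (+%R^~ _) (scale1r _)). Qed.
Fact gamma_oppE s x : gamma_opp s x = - s x.
Proof. by rewrite [LHS]addr0 [LHS]scaleN1r. Qed.
Fact gamma_scaleE f s x : gamma_scale f s x = f x *: s x.
Proof. exact: addr0. Qed.

Fact gamma_addA : associative gamma_add.
Proof. by move=> s t u; apply: gammaP => x; rewrite !gamma_addE addrA. Qed.
Fact gamma_addC : commutative gamma_add.
Proof. by move=> s t; apply: gammaP => x; rewrite !gamma_addE addrC. Qed.
Fact gamma_add0 : left_id gamma_zero gamma_add.
Proof. by move=> s; apply: gammaP => x; rewrite gamma_addE add0r. Qed.
Fact gamma_addN : left_inverse gamma_zero gamma_opp gamma_add.
Proof.
by move=> s; apply: gammaP => x; rewrite gamma_addE gamma_oppE addNr.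
Qed.

HB.instance Definition _ := GRing.isZmodule.Build Gamma
  gamma_addA gamma_addC gamma_add0 gamma_addN.

Fact gamma_scaleA f h s :
  gamma_scale f (gamma_scale h s) = gamma_scale (f * h) s.
Proof. by apply: gammaP => x; rewrite !gamma_scaleE scalerA. Qed.
Fact gamma_scale1 : left_id 1 gamma_scale.
Proof. by move=> s; apply: gammaP => x; rewrite gamma_scaleE scale1r. Qed.
Fact gamma_scaleDr : right_distributive gamma_scale +%R.
Proof.
by move=> f s t; apply: gammaP => x; rewrite !(gamma_scaleE, gamma_addE) scalerDr.
Qed.
Fact gamma_scaleDl s : {morph gamma_scale^~ s : f h / f + h}.
Proof.
by move=> f h; apply: gammaP => x; rewrite !(gamma_scaleE, gamma_addE) scalerDl.
Qed.

HB.instance Definition _ := GRing.Zmodule_isLmodule.Build (smoothfun M) Gamma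
  gamma_scaleA gamma_scale1 gamma_scaleDr gamma_scaleDl.

End Sections.

(* Smoothness of fiberwise linear maps, tested on smooth local sections. *)
Record bundle_map (R : realType) (M : manifold R) (F G : smooth_family M) :=
  BundleMap {
  bmap :> forall x, {linear F x -> G x};
  bmap_smooth : forall U s, open U ->
    smooth_sec U s -> smooth_sec U (fun x => bmap x (s x)) }.

Definition bmap_sec (R : realType) (M : manifold R) (F G : smooth_family M)
    (phi : bundle_map F G) (s : Gamma F) : Gamma G :=
  GammaSec (bmap_smooth phi openT (gamma_smooth s)).

Section TangentBundle.
Context (R : realType) (M : manifold R).

Definition smooth_vf (U : set M) (X : forall x : M, tangent x) : Prop :=
  forall f : smoothfun M, smooth_on U (fun x => X x f).

Fact smooth_vf0 U : smooth_vf U (fun=> 0).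
Proof. by move=> f; exact: smooth_on_cst. Qed.

Fact smooth_vfP U (f : smoothfun M) X Y : open U -> smooth_vf U X ->
  smooth_vf U Y -> smooth_vf U (fun x => f x *: X x + Y x).
Proof.
move=> oU sX sY h; apply: smooth_onD => //; last exact: sY.
by apply: smooth_onM => //; [exact: smoothfun_smooth|exact: sX].
Qed.

Definition TM : smooth_family M := SmoothFamily smooth_vf0 smooth_vfP.

Definition vact (X : Gamma TM) (f : smoothfun M) : smoothfun M :=
  mk_smoothfun (gamma_smooth X f).

Definition lie_at (X Y : Gamma TM) (x : M) (f : smoothfun M) : R^o :=
  X x (vact Y f) - Y x (vact X f).

Fact lie_at_subproof X Y x : lie_at X Y x \in derivation_at x.
Proof.
have actL (Z : Gamma TM) (a : R) f h :
    vact Z (a *: f + h) = a *: vact Z f + vact Z h.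
  by apply/val_inj/funext => z; exact: (proj1 (tangentP (Z z))).
have actM (Z : Gamma TM) f h : vact Z (f * h) = vact Z f * h + f * vact Z h.
  by apply/val_inj/funext => z; exact: (proj2 (tangentP (Z z))).
have TD (v : tangent x) f h : v (f + h) = v f + v h.
  by have := proj1 (tangentP v) 1 f h; rewrite scale1r mul1r.
have TMl (v : tangent x) := proj2 (tangentP v).
have TL (v : tangent x) := proj1 (tangentP v).
apply/asboolP; split=> [a f h|f h]; rewrite /lie_at.
  by rewrite !actL !TL opprD addrACA mulrBr.
rewrite !actM !TD !TMl /=.
have alg (a b c d xf xh yf yh u w : R) :
  a * w + yf * xh + (xf * yh + u * c) - (b * w + xf * yh + (yf * xh + u * d)) =
  (a - b) * w + u * (c - d) by ring.
exact: alg.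
Qed.

Fact lie_smooth X Y : smooth_vf setT (fun x => Tangent (lie_at_subproof X Y x)).
Proof.
move=> f; have -> : (fun x => Tangent (lie_at_subproof X Y x) f) =
    (fun x => vact X (vact Y f) x + - 1 * vact Y (vact X f) x).
  by apply/funext => x; rewrite mulN1r.
apply: smooth_onD; [exact: openT|exact: smoothfun_smooth|].
apply: smooth_onM; [exact: openT|exact: smooth_on_cst|exact: smoothfun_smooth].
Qed.

Definition lie (X Y : Gamma TM) : Gamma TM := GammaSec (F := TM) (@lie_smooth X Y).

End TangentBundle.

Section VectorBundles.
Context (R : realType) (M : manifold R).

Record vbundle := VBundle {
  vfib : M -> lmodType R;
  vrank : nat;
  vidx : Type;
  vdom : vidx -> set M;
  vtriv : forall (i : vidx) (x : M), {linear vfib x -> 'rV[R]_vrank};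
  vdom_open : forall i, open (vdom i);
  vdom_cover : forall x, exists i, vdom i x;
  vtriv_bij : forall i x, vdom i x -> bijective (vtriv i x);
  vtriv_trans : forall i j, exists A : M -> 'M[R]_vrank,
    (forall x v, vdom i x -> vdom j x -> vtriv j x v = vtriv i x v *m A x) /\
    (forall a b, smooth_on (vdom i `&` vdom j) (fun x => A x a b)) }.

Definition vb_smooth_sec (E : vbundle) U (s : forall x, vfib E x) : Prop :=
  forall i k, smooth_on (U `&` vdom i) (fun x => vtriv i x (s x) 0 k).

Fact vb_smooth_sec0 (E : vbundle) U : vb_smooth_sec (E := E) U (fun=> 0).
Proof.
move=> i k; under eq_fun do rewrite linear0 mxE.
exact: smooth_on_cst.
Qed.

Fact vb_smooth_secP (E : vbundle) U (f : smoothfun M) s t : open U ->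
  vb_smooth_sec (E := E) U s -> vb_smooth_sec U t ->
  vb_smooth_sec U (fun x => f x *: s x + t x).
Proof.
move=> oU ss st i k; under eq_fun do rewrite linearP !mxE.
have oUi : open (U `&` vdom i) by apply: openI => //; exact: vdom_open.
apply: smooth_onD => //.
by apply: smooth_onM => //; exact: smoothfun_smooth.
Qed.

Definition vb_family (E : vbundle) : smooth_family M :=
  SmoothFamily (@vb_smooth_sec0 E) (@vb_smooth_secP E).

End VectorBundles.

Coercion vb_family : vbundle >-> smooth_family.

Section DirectSum.
Context (R : realType) (M : manifold R) (E C : vbundle M).

Definition dsum_fib (x : M) : lmodType R := (vfib E x * vfib C x)%type.

Definition dsum_triv_fun (ij : vidx E * vidx C) (x : M) (v : dsum_fib x) :
    'rV[R]_(vrank E + vrank C) :=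
  row_mx (vtriv ij.1 x v.1) (vtriv ij.2 x v.2).

Fact dsum_triv_linear ij x : linear (@dsum_triv_fun ij x).
Proof.
move=> a [u1 u2] [v1 v2]; rewrite /dsum_triv_fun /= !linearP.
by rewrite scale_row_mx add_row_mx.
Qed.

HB.instance Definition _ ij x := GRing.isLinear.Build R (dsum_fib x)
  'rV[R]_(vrank E + vrank C) *:%R (@dsum_triv_fun ij x)
  (@dsum_triv_linear ij x).

Definition dsum_dom (ij : vidx E * vidx C) : set M := vdom ij.1 `&` vdom ij.2.

Fact dsum_dom_open ij : open (dsum_dom ij).
Proof. by apply: openI; exact: vdom_open. Qed.

Fact dsum_dom_cover x : exists ij, dsum_dom ij x.
Proof.
have [i xi] := vdom_cover E x; have [j xj] := vdom_cover C x.
by exists (i, j).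
Qed.

Fact dsum_triv_bij ij x : dsum_dom ij x -> bijective (@dsum_triv_fun ij x).
Proof.
move=> [/vtriv_bij[f fK Kf] /vtriv_bij[g gK Kg]].
exists (fun w => (f (lsubmx w), g (rsubmx w))) => [[u v]|w].
  by rewrite /dsum_triv_fun /= row_mxKl row_mxKr fK gK.
by rewrite /dsum_triv_fun /= Kf Kg hsubmxK.
Qed.

Fact dsum_triv_trans ij kl : exists A : M -> 'M[R]_(vrank E + vrank C),
  (forall x v, dsum_dom ij x -> dsum_dom kl x ->
     dsum_triv_fun kl v = @dsum_triv_fun ij x v *m A x) /\
  (forall a b, smooth_on (dsum_dom ij `&` dsum_dom kl) (fun x => A x a b)).
Proof.
have [A [AE As]] := vtriv_trans ij.1 kl.1.
have [B [BE Bs]] := vtriv_trans ij.2 kl.2.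
exists (fun x => block_mx (A x) 0 0 (B x)); split=> [x v [i1 i2] [k1 k2]|a b].
  by rewrite /dsum_triv_fun mul_row_block !mulmx0 addr0 add0r AE // BE.
case: (split_ordP a) => a' ->; case: (split_ordP b) => b' ->.
- under eq_fun do rewrite block_mxEul.
  by apply: smooth_on_sub (As a' b') => x [[? _] [? _]].
- under eq_fun do rewrite block_mxEur mxE; exact: smooth_on_cst.
- under eq_fun do rewrite block_mxEdl mxE; exact: smooth_on_cst.
- under eq_fun do rewrite block_mxEdr.
  by apply: smooth_on_sub (Bs a' b') => x [[_ ?] [_ ?]].
Qed.

Definition dsum : vbundle M :=
  VBundle (vtriv := fun ij x => @dsum_triv_fun ij x)
    dsum_dom_open dsum_dom_cover dsum_triv_bij dsum_triv_trans.

Lemma dsum_smooth_fst U (s : forall x, dsum x) :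
  smooth_sec U s -> smooth_sec (F := E) U (fun x => (s x).1).
Proof.
move=> ss i k; apply: smooth_on_local => x [Ux xi].
have [j xj] := vdom_cover C x.
exists (U `&` dsum_dom (i, j)) => //.
have := ss (i, j) (lshift _ k).
by under eq_fun do rewrite /= /dsum_triv_fun row_mxEl.
Qed.

Lemma dsum_smooth_snd U (s : forall x, dsum x) :
  smooth_sec U s -> smooth_sec (F := C) U (fun x => (s x).2).
Proof.
move=> ss j k; apply: smooth_on_local => x [Ux xj].
have [i xi] := vdom_cover E x.
exists (U `&` dsum_dom (i, j)) => //.
have := ss (i, j) (rshift _ k).
by under eq_fun do rewrite /= /dsum_triv_fun row_mxEr.
Qed.

Lemma dsum_smooth_pair U (s : forall x, E x) (t : forall x, C x) :
  smooth_sec U s -> smooth_sec U t ->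
  smooth_sec (F := dsum) U (fun x => (s x, t x)).
Proof.
move=> ss st [i j] k; case: (split_ordP k) => k' ->.
  under eq_fun do rewrite /dsum_triv_fun row_mxEl.
  by apply: smooth_on_sub (ss i k') => x [? [? _]].
under eq_fun do rewrite /dsum_triv_fun row_mxEr.
by apply: smooth_on_sub (st j k') => x [? [_ ?]].
Qed.

Definition sec_fst (s : Gamma dsum) : Gamma E :=
  GammaSec (F := E) (dsum_smooth_fst (gamma_smooth s)).
Definition sec_snd (s : Gamma dsum) : Gamma C :=
  GammaSec (F := C) (dsum_smooth_snd (gamma_smooth s)).
Definition sec_pair (s : Gamma E) (t : Gamma C) : Gamma dsum :=
  GammaSec (F := dsum) (dsum_smooth_pair (gamma_smooth s) (gamma_smooth t)).

Section AnchorSum.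
Context (G : smooth_family M) (rho : bundle_map E G).

Definition dsum_map_fun (x : M) (v : dsum x) : G x := rho x v.1.

Fact dsum_map_linear x : linear (@dsum_map_fun x).
Proof. by move=> a u v; rewrite /dsum_map_fun linearP. Qed.

HB.instance Definition _ x := GRing.isLinear.Build R (dsum x) (G x) *:%R
  (@dsum_map_fun x) (@dsum_map_linear x).

Fact dsum_map_smooth U (s : forall x, dsum x) : open U ->
  smooth_sec U s -> smooth_sec U (fun x => dsum_map_fun (s x)).
Proof.
by move=> oU ss; apply: (bmap_smooth rho oU); exact: dsum_smooth_fst ss.
Qed.

(* rho (+) 0 : E (+) C -> G *)
Definition dsum_map : bundle_map dsum G :=
  @BundleMap R M dsum G (fun x => @dsum_map_fun x) dsum_map_smooth.

End AnchorSum.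

End DirectSum.

Section PseudoEuclidean.
Context (R : realType) (M : manifold R).

Record pe_bundle := PEBundle {
  pe_vb :> vbundle M;
  pe_metric : forall x, pe_vb x -> pe_vb x -> R;
  pe_sym : forall x u v, pe_metric u v = pe_metric (x := x) v u;
  pe_linear : forall x (a : R) u v w,
    pe_metric (x := x) (a *: u + v) w = a * pe_metric u w + pe_metric v w;
  pe_nondeg : forall x u, (forall v, pe_metric (x := x) u v = 0) -> u = 0;
  pe_smooth : forall U s t, open U ->
    smooth_sec (F := pe_vb) U s -> smooth_sec (F := pe_vb) U t ->
    smooth_on U (fun x => pe_metric (s x) (t x)) }.

Definition pe_inner (E : pe_bundle) (s t : Gamma E) : smoothfun M :=
  mk_smoothfun (pe_smooth openT (gamma_smooth s) (gamma_smooth t)).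

Section Sum.
Context (E C : pe_bundle).

Definition dsum_metric (x : M) (u v : dsum E C x) : R :=
  pe_metric u.1 v.1 + pe_metric u.2 v.2.

Fact dsum_metric_sym x u v : dsum_metric u v = dsum_metric (x := x) v u.
Proof. by rewrite /dsum_metric (pe_sym u.1) (pe_sym u.2). Qed.

Fact dsum_metric_linear x (a : R) u v w :
  dsum_metric (x := x) (a *: u + v) w = a * dsum_metric u w + dsum_metric v w.
Proof. by rewrite /dsum_metric !pe_linear mulrDr addrACA. Qed.

Fact pe_metric0 (F : pe_bundle) x (u : F x) : pe_metric u 0 = 0.
Proof.
rewrite pe_sym; have := pe_linear (-1) (0 : F x) 0 u.
by rewrite scaler0 addr0 mulN1r addNr.
Qed.

Fact dsum_metric_nondeg x u :
  (forall v, dsum_metric (x := x) u v = 0) -> u = 0.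
Proof.
case: u => u1 u2 H; congr pair; apply: pe_nondeg => v.
  by have := H (v, 0); rewrite /dsum_metric /= pe_metric0 addr0.
by have := H (0, v); rewrite /dsum_metric /= pe_metric0 add0r.
Qed.

Fact dsum_metric_smooth U (s t : forall x, dsum E C x) : open U ->
  smooth_sec U s -> smooth_sec U t ->
  smooth_on U (fun x => dsum_metric (s x) (t x)).
Proof.
move=> oU ss st; apply: smooth_onD => //.
  by apply: pe_smooth => //; exact: dsum_smooth_fst.
by apply: pe_smooth => //; exact: dsum_smooth_snd.
Qed.

(* (E (+) C, g (+) g0) *)
Definition pe_dsum : pe_bundle :=
  PEBundle (pe_vb := dsum E C) dsum_metric_sym dsum_metric_linear
    dsum_metric_nondeg dsum_metric_smooth.

End Sum.

End PseudoEuclidean.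

Section Foliations.
Context (R : realType).

(* On (Hausdorff, second countable) manifolds, a map is smooth iff it pulls
   smooth functions back to smooth functions. *)
Record smooth_map (N M : manifold R) := SmoothMap {
  smap :> N -> M;
  smap_smooth : forall f : smoothfun M, smooth_on setT (f \o smap) }.

Section Differential.
Context (N M : manifold R) (phi : smooth_map N M).

Definition pullback (f : smoothfun M) : smoothfun N :=
  mk_smoothfun (smap_smooth phi f).

Fact differential_subproof (y : N) (v : tangent y) :
  ((fun f => v (pullback f)) : smoothfun M -> R^o) \in derivation_at (phi y).
Proof.
have [vL vM] := tangentP v; apply/asboolP; split=> [a f h|f h].
  by rewrite -vL; congr (v _); apply/val_inj/funext.
by rewrite -[f (phi y)]/(pullback f y) -[h (phi y)]/(pullback h y) -vM;
  congr (v _); apply/val_inj/funext.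
Qed.

Definition differential (y : N) (v : tangent y) : tangent (phi y) :=
  Tangent (differential_subproof v).

End Differential.

(* A distribution is a (generalized, i.e. Stefan-Sussmann) foliation if through
   every point there passes a connected, injectively immersed integral
   manifold, whose tangent spaces are the planes of the distribution; the
   dimension of the latter may vary from point to point. *)
Definition foliation (M : manifold R) (D : forall x : M, set (tangent x)) : Prop :=
  forall x, exists (N : manifold R) (phi : smooth_map N M),
    [/\ connected [set: N], injective phi, range phi x &
        forall y, injective (@differential N M phi y) /\
                  range (@differential N M phi y) = D (phi y)].

End Foliations.

Section Courant.
Context (R : realType) (M : manifold R).

Section OneBundle.
Context (E : pe_bundle M) (rho : bundle_map E (TM M)).

(* The vector representing a linear form on E_x; it exists and is unique by
   non-degeneracy, since E_x has finite dimension. *)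
Definition sharp (x : M) (alpha : E x -> R) : E x :=
  xget 0 [set u | forall v, pe_metric u v = alpha v].

Definition courant_d_at (x : M) (alpha : tangent x -> R) : E x :=
  2^-1 *: sharp (fun e => alpha (rho x e)).

Definition courant_d (f : smoothfun M) (x : M) : E x :=
  courant_d_at (fun v : tangent x => v f).

Definition courant_vb : Prop :=
  foliation (fun x => range (rho x)) /\
  forall (x : M) (alpha beta : {scalar tangent x}),
    pe_metric (courant_d_at alpha) (courant_d_at beta) = 0.

Context (br : Gamma E -> Gamma E -> Gamma E).

Definition skew_bracket : Prop :=
  (forall e1 e2, br e1 e2 = - br e2 e1) /\
  (forall (a : R) e1 e2 e3, br (cst_smoothfun M a *: e1 + e2) e3 =
     cst_smoothfun M a *: br e1 e3 + br e2 e3).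

Definition pre_courant : Prop :=
  [/\ courant_vb, skew_bracket,
      forall e1 e2,
        bmap_sec rho (br e1 e2) = lie (bmap_sec rho e1) (bmap_sec rho e2) &
      forall e e1 e2 (x : M),
        vact (bmap_sec rho e) (pe_inner e1 e2) x =
        pe_metric (br e e1 x + courant_d (pe_inner e e1) x) (e2 x) +
        pe_metric (e1 x) (br e e2 x + courant_d (pe_inner e e2) x)].

Definition courant : Prop :=
  pre_courant /\
  forall e1 e2 e3 (x : M),
    br (br e1 e2) e3 x + br (br e2 e3) e1 x + br (br e3 e1) e2 x =
    3^-1 *: courant_d (pe_inner (br e1 e2) e3 + pe_inner (br e2 e3) e1 +
                       pe_inner (br e3 e1) e2) x.

End OneBundle.

Section Connections.
Context (C : pe_bundle M) (nabla : Gamma (TM M) -> Gamma C -> Gamma C).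

Definition connection : Prop :=
  [/\ forall f X Y c, nabla (f *: X + Y) c = f *: nabla X c + nabla Y c,
      forall X c d, nabla X (c + d) = nabla X c + nabla X d &
      forall X f c, nabla X (f *: c) = vact X f *: c + f *: nabla X c].

Definition metric_connection : Prop :=
  connection /\
  forall X c d, vact X (pe_inner c d) =
    pe_inner (nabla X c) d + pe_inner c (nabla X d).

Definition curvature (X Y : Gamma (TM M)) (c : Gamma C) : Gamma C :=
  nabla X (nabla Y c) - nabla Y (nabla X c) - nabla (lie X Y) c.

(* The brackets on E (+) C only involve nabla_(rho e), hence only detect the
   curvature along rho(Gamma E); with S = setT this is flatness of nabla. *)
Definition flat_along (S : set (Gamma (TM M))) : Prop :=
  forall X Y c, S X -> S Y -> curvature X Y c = 0.

Definition flat : Prop := flat_along setT.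

End Connections.

Section SumBracket.
Context (E C : pe_bundle M) (rho : bundle_map E (TM M)).
Context (br : Gamma E -> Gamma E -> Gamma E).
Context (nabla : Gamma (TM M) -> Gamma C -> Gamma C).
Context (gamma0 : Gamma C -> Gamma C -> Gamma E).

Definition is_gamma0 : Prop := forall c1 c2 e,
  pe_inner (gamma0 c1 c2) e =
  cst_smoothfun M 2^-1 *
    (pe_inner c1 (nabla (bmap_sec rho e) c2) -
     pe_inner c2 (nabla (bmap_sec rho e) c1)).

(* The biadditive extension of the brackets [e1, e2], [e, c] = - [c, e] =
   nabla_(rho e) c and [c1, c2] = - gamma0 c1 c2. *)
Definition dsum_bracket (s t : Gamma (pe_dsum E C)) : Gamma (pe_dsum E C) :=
  let e1 := sec_fst s in let c1 := sec_snd s in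
  let e2 := sec_fst t in let c2 := sec_snd t in
  sec_pair (br e1 e2 - gamma0 c1 c2)
           (nabla (bmap_sec rho e1) c2 - nabla (bmap_sec rho e2) c1).

End SumBracket.

End Courant.

(* Main.v *)
From HB Require Import structures.
Require Import Defs.
From mathcomp Require Import all_boot all_order all_algebra.
From mathcomp Require Import all_classical all_reals.
From mathcomp Require Import topology normedtype derive sequences realfun exp.
From mathcomp Require Import ring lra.

Set Implicit Arguments.
Unset Strict Implicit.
Unset Printing Implicit Defensive.

Import Order.TTheory GRing.Theory Num.Theory.
Import numFieldNormedType.Exports.

(** The section [gamma0 c1 c2] is defined by its inner products with all sections
   [e], through an expression that is [C^oo]-linear in [e].  It exists, uniquely,
   by a smooth version of the Riesz representation theorem ([section_riesz]).
   This needs bump functions ([bump_exists]): they extend local frames to global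
   sections, so that a [C^oo]-linear map is determined fiberwise
   ([tensor_local]).  The same theorem makes the differential of a function into
   a global section [grad rho f], and the whole argument becomes algebra over
   the ring of smooth functions.

   Pre-Courant axioms.  Isotropy means that [rho (grad rho f) = 0]
   ([anchor_grad]); as [gamma0] is made of covariant derivatives along
   [rho e], it is orthogonal to all gradients, that is, [rho] kills it
   ([anchor_gamma0]).  Hence the anchor still preserves brackets.  Invariance of
   the inner product ([dsum_metric_br]) holds because [nabla] is metric: when [s] acts
   on the inner product of [s1] and [s2], the covariant derivatives along
   [rho e1] and [rho e2], which come from the mixed brackets, from [gamma0] and
   from the gradient terms, cancel thanks to the factor one half in [gamma0].

   Courant axiom.  The [C]-component of the Jacobi identity is the vanishing of
   a cyclic sum of curvatures along the image of the anchor
   ([dsum_jacobiator_snd]); sections with a single component in [C] recover each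
   curvature term, so that flatness along that image is necessary
   ([dsum_courant]).  Conversely, flatness makes [gamma0] equivariant under the
   bracket up to a gradient ([br_gamma0]), and summing this cyclically gives the
   [E]-component ([dsum_jacobi]). *)

Local Open Scope classical_set_scope.
Local Open Scope ring_scope.

(** * Smooth functions of one variable composed with smooth functions *)

Section Calculus.
Context {R : realType}.

Lemma is_derive_comp_dir (V : normedModType R) (phi : R -> R) (u : V -> R)
    (y v : V) (a : R) :
  is_derive (u y) 1 phi a -> derivable u y v ->
  is_derive y v (phi \o u) (a * 'D_v u y).
Proof.
move=> dphi du.
pose w (t : R) := u (t *: v + y).
have w0 : w 0 = u y by rewrite /w scale0r add0r.
have dw : derivable w 0 1 by exact: (derivable1P u y v).1.
have Dw (f : V -> R) : 'D_1 (fun t : R => f (t *: v + y)) 0 = 'D_v f y.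
  rewrite /derive; set p := (fun h => _ : R); set q := (fun h => _ : R).
  suff -> : p = q by [].
  apply/funext => h; rewrite /p /q /=.
  by rewrite addr0 scale0r add0r [_%:A]mulr1.
have [dc Dc] : is_derive (0 : R) 1 (phi \o w) (a * 'D_1 w 0).
  by apply: is_derive1_comp; [rewrite w0|exact: derivableP].
apply: DeriveDef; first by apply: (derivable1P (phi \o u) y v).2.
by rewrite -Dw -(Dw u).
Qed.

(** Smoothness of [phi m \o u] is inherited from [u] by induction on the order,
   provided that differentiating one member of the family [phi] only produces
   other members of the same family.  A single induction then covers both inverse
   powers and flat exponentials. *)
Lemma Ck_comp_family n (phi : nat -> R -> R) (a b : nat -> R)
    (U : set 'rV[R]_n) (u : 'rV[R]_n -> R) :
  open U -> Cinfty U u ->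
  (forall m y, U y -> is_derive (u y) 1 (phi m)
     (a m * phi m.+1 (u y) + b m * phi m.+2 (u y))) ->
  forall m, Cinfty U (phi m \o u).
Proof.
move=> oU su dphi m k.
have cphi j y : U y -> {for y, continuous (phi j \o u)}.
  move=> Uy; apply: continuous_comp; first exact: (Ck_cont (su 0%N)).
  apply: differentiable_continuous; apply/derivable1_diffP.
  by case: (dphi j _ Uy).
elim: k m => [|k IH] m; first by split=> // y; exact: cphi.
split=> [y|i]; first exact: cphi.
have [du ku] := (su k.+1).2 i.
have D y (Uy : U y) := is_derive_comp_dir (dphi m _ Uy) (du _ Uy).
split=> [y /D[]//|].
apply: (@Ck_ext _ _ k U (fun y => (a m * (phi m.+1 \o u) y +
   b m * (phi m.+2 \o u) y) * 'D_(delta_mx 0 i) u y)) => //.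
  by move=> y /D[_ ->].
apply: CkM => //; apply: CkD => //; apply: CkM => //; exact: Ck_cst.
Qed.

Lemma Cinfty_inv n (U : set 'rV[R]_n) (u : 'rV[R]_n -> R) : open U ->
  Cinfty U u -> (forall y, U y -> u y != 0) -> Cinfty U (fun y => (u y)^-1).
Proof.
move=> oU su u0.
apply: (@Ck_comp_family n (fun m t => t^-1 ^+ m) (fun m => - m%:R) (fun=> 0)
  U u oU su _ 1%N) => m y Uy.
have dV : is_derive (u y) (1 : R) (fun t : R => t^-1) (- (u y) ^- 2 *: 1).
  by apply: (@is_deriveV R id); exact: u0.
have -> : (fun t : R => t^-1 ^+ m) = (fun t : R => t^-1) ^+ m.
  by apply/funext => t; rewrite fctE.
apply: is_derive_eq.
rewrite mul0r addr0 [_ *: 1]mulr1 [_ *: _]mulrN mulNr; congr (- _).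
case: m => [|m]; first by rewrite !mul0r.
by rewrite -exprVn -mulrA -exprD addn2.
Qed.

(** The factors [t^-1 ^+ m] make the family closed under differentiation up to
   linear combinations; [m = 0] is the classical smooth function that is flat
   at the origin. *)
Definition flat_exp (m : nat) (t : R) : R :=
  if 0 < t then t^-1 ^+ m * expR (- t^-1) else 0.

(** One estimate settles the derivative at the origin for all [m]: a quadratic
   bound gives value and derivative 0 there. *)
Lemma flat_exp_bound m t : `|flat_exp m t| <= (m.+2)`!%:R * t ^+ 2.
Proof.
rewrite /flat_exp; case: ifPn => [t0|_]; last first.
  by rewrite normr0 mulr_ge0 // sqr_ge0.
have ti0 : 0 <= t^-1 by rewrite invr_ge0 ltW.
rewrite ger0_norm ?mulr_ge0 ?exprn_ge0 ?expR_ge0 // expRN.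
rewrite ler_pdivrMr ?expR_gt0 //.
have f0 : (0 : R) < (m.+2)`!%:R by rewrite ltr0n fact_gt0.
apply: (@le_trans _ _ ((m.+2)`!%:R * t ^+ 2 * (t^-1 ^+ m.+2 / (m.+2)`!%:R))).
  rewrite [leRHS](_ : _ = t^-1 ^+ m) //.
  rewrite -addn2 exprD exprVn exprVn; field.
  by rewrite expf_neq0 ?gt_eqF // ?addn2.
rewrite ler_pM2l ?mulr_gt0 ?exprn_gt0 //.
by apply: le_trans (expR_ge1Dxn m.+1 ti0); rewrite lerDr.
Qed.

Lemma flat_exp_derive m (t : R) :
  is_derive t (1 : R) (flat_exp m) (- m%:R * flat_exp m.+1 t + 1 * flat_exp m.+2 t).
Proof.
case: (ltrgtP t 0) => t0.
- apply: (@near_eq_is_derive _ _ _ (cst 0)).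
    by near=> z; rewrite /flat_exp ifF //; apply/negbTE; rewrite -leNgt ltW //;
      near: z; exact: lt_nbhsl.
  rewrite /flat_exp ltNge (ltW t0) /= !mulr0 addr0; exact: is_derive_cst.
- have tn0 : t != 0 by rewrite gt_eqF.
  apply: (@near_eq_is_derive _ _ _
      ((fun z : R => z^-1) ^+ m * (expR \o (- (fun z : R => z^-1))))).
    near=> z; rewrite /flat_exp ifT; first by rewrite !fctE.
    by near: z; exact: lt_nbhsr.
  have dV : is_derive t (1 : R) (fun z : R => z^-1) (- t ^- 2 *: 1).
    by apply: (@is_deriveV R id); exact: tn0.
  apply: is_derive_eq.
  rewrite /flat_exp t0 !fctE [_ *: 1]mulr1 /GRing.scale /=.
  case: m => [|m]; first by field.
  rewrite !exprS; field. exact: tn0.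
- rewrite t0 /flat_exp ltxx !mulr0 addr0 -/(flat_exp m).
  have lim0 : (fun h : R => h^-1 *: ((flat_exp m \o shift 0) (h *: 1) - flat_exp m 0))
      @ 0^' --> (0 : R).
    have f0 : flat_exp m 0 = 0 by rewrite /flat_exp ltxx.
    apply/norm_cvg0P.
    apply: (@squeeze_cvgr _ _ _ _ (cst 0) (fun h : R => (m.+2)`!%:R * `|h|)).
    + near=> h; rewrite normr_ge0 /= f0 subr0 addr0 [_%:A]mulr1 normrM normfV.
      have h0 : h != 0 by near: h; exact: nbhs_dnbhs_neq.
      rewrite ler_pdivrMl ?normr_gt0 //.
      apply: le_trans (flat_exp_bound m h) _.
      by rewrite [leRHS]mulrCA -[`|h| * _]expr2 real_normK ?num_real.
    + exact: cvg_cst.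
    + apply: cvg_within_filter.
      have := @cvgMr _ _ _ _ _ (m.+2)`!%:R _ (@norm_continuous _ R 0).
      by rewrite normr0 mulr0; apply.
  apply: DeriveDef; first by apply: cvgP lim0.
  by rewrite /derive; apply: (@cvg_lim _ _ _ (0^')) lim0.
Unshelve. all: by end_near. Qed.

End Calculus.

(** * Bump functions on a manifold *)

Section Bump.
Context {R : realType} {M : manifold R}.
Implicit Types (U V K : set M) (f g : M -> R).

Lemma smooth_on_ext U f g : open U -> (forall y, U y -> f y = g y) ->
  smooth_on U f -> smooth_on U g.
Proof.
move=> oU fg sf c ac k; apply: Ck_ext (sf c ac k).
  exact: chart_image_open.
by move=> _ [x [Ux dx] <-] /=; rewrite (chart_toK (mem_set dx)) fg.
Qed.

Lemma smooth_on_sum U (I : Type) (r : seq I) (P : pred I) (F : I -> M -> R) :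
  open U -> (forall i, smooth_on U (F i)) ->
  smooth_on U (fun x => \sum_(i <- r | P i) F i x).
Proof.
move=> oU sF; elim: r => [|i r IH].
  by under eq_fun do rewrite big_nil; exact: smooth_on_cst.
under eq_fun do rewrite big_cons.
by case: (P i) => //; exact: smooth_onD.
Qed.

Lemma smooth_on_inv U f : open U -> smooth_on U f ->
  (forall y, U y -> f y != 0) -> smooth_on U (fun y => (f y)^-1).
Proof.
move=> oU sf f0 c ac.
apply: (@Cinfty_inv _ _ _ (f \o chart_from c)).
- exact: chart_image_open.
- exact: sf.
- by move=> _ [x [Ux dx] <-] /=; rewrite (chart_toK (mem_set dx)); exact: f0.
Qed.

Lemma smooth_on_coord (c : chart R (mdim M) M) i : atlas c ->
  smooth_on (chart_dom c) (fun y => c y 0 i).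
Proof. by move=> ac c' ac'; rewrite setIC; exact: atlas_compat. Qed.

Lemma smoothfun_continuous (f : smoothfun M) : continuous f.
Proof.
move=> x; have [c ac cx] := atlas_cover x.
have Ix : (c @` (setT `&` chart_dom c)) (c x) by exists x.
have cf := Ck_cont (smoothfun_smooth f setT ac 0%N) Ix.
have nE : \forall y \near x, (f \o chart_from c) (c y) = f y.
  apply: filterS (open_nbhs_nbhs (conj (@chart_dom_open _ _ _ c) cx)) => y dy /=.
  by rewrite (chart_toK (mem_set dy)).
have cc : {for x, continuous ((f \o chart_from c) \o c)}.
  by apply: continuous_comp; [exact: chart_to_cont|exact: cf].
rewrite /continuous_at -(nbhs_singleton nE).
by apply: cvg_trans (near_eq_cvg nE) _; exact: cc.
Qed.

Lemma open_smoothfun_neq0 (f : smoothfun M) : open [set y | f y != 0].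
Proof.
have -> : [set y | f y != 0] = f @^-1` [set~ 0].
  by apply/seteqP; split=> y /= /eqP.
apply: open_comp => [y _|]; first exact: smoothfun_continuous.
by rewrite openC; exact: closed_eq.
Qed.

(** In a chart around [x], compose the flat exponential with
   [d ^+ 2 - |c y - c x| ^+ 2] (Euclidean norm) and extend by 0.  The support is
   the image of a compact ball, hence closed because the manifold is Hausdorff;
   this is what makes the extension by 0 smooth. *)
Lemma bump_exists U (x : M) : open U -> U x ->
  exists (chi : smoothfun M) (K : set M),
    [/\ chi x != 0, closed K, K `<=` U & forall y, ~ K y -> chi y = 0].
Proof.
move=> oU Ux; have [c ac cx] := atlas_cover x.
pose W := c @` (U `&` chart_dom c).
have oW : open W by exact: chart_image_open.
have : nbhs (c x) W by apply: open_nbhs_nbhs; split=> //; exists x.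
move=> /nbhs_ballP[r r0 rW].
pose d := r / 2.
have d0 : 0 < d by rewrite divr_gt0.
pose B := [set z : 'rV[R]_(mdim M) | `|c x - z| <= d].
have BW : B `<=` W.
  move=> z zB; apply: rW; rewrite -ball_normE /=.
  by apply: le_lt_trans zB _; rewrite ltr_pdivrMr // ltr_pMr // ltr1n.
have WE z : W z -> [/\ U (chart_from c z), chart_dom c (chart_from c z) &
    c (chart_from c z) = z].
  by move=> [y [Uy dy] <-]; rewrite (chart_toK (mem_set dy)).
have cB : compact B.
  apply: bounded_closed_compact.
    exists (`|c x| + d); split; first exact: num_real.
    move=> N Nlt z zB; apply: le_trans (ltW Nlt).
    rewrite -[z](subKr (c x)); apply: le_trans (ler_normB _ _) _.
    by rewrite lerD2l.
  exact: closed_closed_ball_.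
pose K := chart_from c @` B.
have cK : compact K.
  apply: continuous_compact cB; apply: continuous_in_subspaceT => z.
  move=> /set_mem /BW [y [_ dy] <-]; apply: chart_from_cont; by exists y.
have clK : closed K by apply: compact_closed cK; exact: manifold_hausdorff.
pose q (y : M) := d ^+ 2 - \sum_i (c y 0 i - c x 0 i) ^+ 2.
have oc : open (chart_dom c) by exact: chart_dom_open.
have sq : smooth_on (chart_dom c) q.
  have sxi i : smooth_on (chart_dom c) (fun y => c y 0 i + - c x 0 i).
    by apply: smooth_onD => //; [exact: smooth_on_coord|exact: smooth_on_cst].
  apply: (@smooth_on_ext _ (fun y => d ^+ 2 + -1 * \sum_i
      (c y 0 i + - c x 0 i) * (c y 0 i + - c x 0 i))) => //.
    by move=> y _; rewrite mulN1r.
  apply: smooth_onD => //; first exact: smooth_on_cst.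
  apply: smooth_onM => //; first exact: smooth_on_cst.
  by apply: smooth_on_sum => // i; exact: smooth_onM.
(* The sup-norm ball contains the Euclidean ball of the same radius. *)
have qB y : 0 < q y -> B (c y).
  rewrite subr_gt0 => qy; rewrite /B /= [`|_|]mx_normrE.
  apply/bigmax_leP; split; first exact: ltW.
  move=> [j i] _ /=; rewrite (ord1 j) !mxE.
  rewrite -(@ler_pXn2r _ 2) ?nnegrE ?(ltW d0) // real_normK ?num_real //.
  rewrite -sqrrN opprB; apply: le_trans (ltW qy).
  rewrite (bigD1 i) //= lerDl; apply: sumr_ge0 => k _; exact: sqr_ge0.
pose chi0 y := if y \in chart_dom c then flat_exp 0 (q y) else 0.
have flat_exp_neq0 t : 0 < t -> flat_exp 0 t != 0 :> R.
  by move=> t0; rewrite /flat_exp t0 expr0 mul1r gt_eqF // expR_gt0.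
have chiK y : ~ K y -> chi0 y = 0.
  move=> nK; rewrite /chi0; case: ifPn => // /[dup] yd /set_mem dy.
  rewrite /flat_exp; case: ifPn => // /qB Bcy; case: nK; exists (c y) => //.
  by rewrite chart_toK.
have oKc : open (~` K) by rewrite openC.
have schi : smooth_on setT chi0.
  apply: smooth_on_local => y _; have [yd|ynd] := pselect (chart_dom c y).
    exists (chart_dom c) => //.
    apply: (@smooth_on_ext _ (fun y => flat_exp 0 (q y))).
    - exact: chart_dom_open.
    - by move=> z dz; rewrite /chi0 mem_set.
    move=> c' ac'.
    have oI : open (c' @` (chart_dom c `&` chart_dom c')).
      exact/chart_image_open/chart_dom_open.
    apply: (@Ck_comp_family _ _ flat_exp (fun m => - m%:R) (fun=> 1) _
      (q \o chart_from c')) => //.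
      exact: sq.
    move=> m z _; exact: flat_exp_derive.
  exists (~` K) => [|/=].
    move=> [z /BW /WE[_ dz _] zy]; by apply: ynd; rewrite -zy.
  apply: (@smooth_on_ext _ (fun=> 0)) => //; last exact: smooth_on_cst.
  by move=> z nKz; rewrite chiK.
exists (mk_smoothfun schi), K; split=> //.
- rewrite /= /chi0 mem_set //; apply: flat_exp_neq0; rewrite /q big1.
    by rewrite subr0 exprn_gt0.
  by move=> i _; rewrite subrr expr0n.
- by move=> _ [z zB <-]; have [] := WE _ (BW _ zB).
Qed.

End Bump.

(** * Evaluation of smooth functions and of sections *)

Section Evaluation.
Context {R : realType} {M : manifold R}.

Definition eval_at (y : M) (f : smoothfun M) : R := f y.

Fact eval_at_zmod y : zmod_morphism (eval_at y).
Proof. by []. Qed.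

Fact eval_at_monoid y : monoid_morphism (eval_at y).
Proof. by []. Qed.

HB.instance Definition _ y :=
  GRing.isZmodMorphism.Build (smoothfun M) R (eval_at y) (eval_at_zmod y).
HB.instance Definition _ y :=
  GRing.isMonoidMorphism.Build (smoothfun M) R (eval_at y) (eval_at_monoid y).

Lemma smoothfunP (f g : smoothfun M) : (forall x, f x = g x) -> f = g.
Proof. by move=> fg; apply/val_inj/funext. Qed.

Lemma smoothfunDE (f g : smoothfun M) x : (f + g) x = f x + g x.
Proof. by []. Qed.
Lemma smoothfunNE (f : smoothfun M) x : (- f) x = - f x.
Proof. by []. Qed.
Lemma smoothfunME (f g : smoothfun M) x : (f * g) x = f x * g x.
Proof. by []. Qed.
Lemma smoothfun0E x : (0 : smoothfun M) x = 0.
Proof. by []. Qed.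

Section Sections.
Context {F : smooth_family M}.
Implicit Types s t : Gamma F.

Lemma gammaDE s t x : (s + t) x = s x + t x.
Proof. exact: gamma_addE. Qed.
Lemma gammaNE s x : (- s) x = - s x.
Proof. exact: gamma_oppE. Qed.
Lemma gammaZE (f : smoothfun M) s x : (f *: s) x = f x *: s x.
Proof. exact: gamma_scaleE. Qed.
Lemma gamma0E x : (0 : Gamma F) x = 0.
Proof. by []. Qed.

Lemma gamma_sumE n (s : 'I_n -> Gamma F) x : (\sum_k s k) x = \sum_k s k x.
Proof. by elim/big_ind2: _ => // a b c d <- <-; exact: gammaDE. Qed.

End Sections.
End Evaluation.

Definition gammaE := (@gammaDE, @gammaNE, @gammaZE, @gamma0E).
Definition smoothfunE := (@smoothfunDE, @smoothfunNE, @smoothfunME, @smoothfun0E).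

(** * Cutting off local data *)

Section CutOff.
Context {R : realType} {M : manifold R}.
Context (U K : set M) (chi : smoothfun M).
Hypotheses (oU : open U) (cK : closed K) (KU : K `<=` U).
Hypothesis chi0 : forall y, ~ K y -> chi y = 0.

(** Points outside [U] have the open neighbourhood [~` K], on which the product is
   0; so the junk values of [f] outside [U] are harmless, and no extension of [f]
   has to be chosen. *)
Lemma cutoff_smooth W (f : M -> R) : open W -> smooth_on (W `&` U) f ->
  smooth_on W (fun y => chi y * f y).
Proof.
move=> oW sf; apply: smooth_on_local => x Wx; have [Ux|nUx] := pselect (U x).
  exists (W `&` U) => //; apply: smooth_onM => //; first exact: openI.
  exact: smoothfun_smooth.
exists (~` K); first by move=> /KU.
apply: (@smooth_on_ext _ _ _ (fun=> 0)); last exact: smooth_on_cst.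
  by rewrite openC.
by move=> y /chi0 ->; rewrite mul0r.
Qed.

Lemma cutoff_smooth_sec (E : vbundle M) (s : forall x, E x) :
  smooth_sec U s -> smooth_sec setT (fun y => chi y *: s y).
Proof.
move=> ss j k; under eq_fun do rewrite linearZ mxE.
have oj := vdom_open (v := E) j.
apply: cutoff_smooth; first exact: openI openT oj.
by rewrite setTI setIC; exact: ss.
Qed.

End CutOff.

(** * Local frames and tensoriality *)

Section Frames.
Context {R : realType} {M : manifold R} (E : vbundle M).

Lemma vtriv_inj i x : vdom (v := E) i x -> injective (vtriv i x).
Proof. by move=> /vtriv_bij /bij_inj. Qed.

Definition vframe (i : vidx E) (k : 'I_(vrank E)) (x : M) : E x :=
  xget 0 [set u : E x | vtriv i x u = delta_mx 0 k].

Lemma vframeE i k x : vdom i x -> vtriv i x (vframe i k x) = delta_mx 0 k.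
Proof.
move=> /vtriv_bij[f fK Kf]; rewrite /vframe; case: xgetP => [_ _ //|H].
by have := H (f (delta_mx 0 k)); rewrite /= Kf.
Qed.

Lemma vframe_smooth i k : smooth_sec (F := E) (vdom i) (vframe i k).
Proof.
move=> j l; have [A [AE sA]] := vtriv_trans i j.
apply: smooth_on_ext (sA k l); first by apply: openI; exact: vdom_open.
by move=> y [iy jy]; rewrite AE // vframeE // -rowE mxE.
Qed.

Lemma frame_decomp i x (b : R) (u : 'I_(vrank E) -> E x) : vdom i x ->
  (forall k, vtriv i x (u k) = b *: delta_mx 0 k) ->
  forall v, b *: v = \sum_k (vtriv i x v) 0 k *: u k.
Proof.
move=> ix uE v; apply: (vtriv_inj ix); rewrite linearZ linear_sum /=.
rewrite {1}[vtriv i x v]row_sum_delta scaler_sumr; apply: eq_bigr => k _.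
by rewrite [RHS]linearZ /= uE !scalerA mulrC.
Qed.

(** Multiplying a trivializing frame by a bump function [b] gives global sections
   [eps k], which still form a frame where [b] does not vanish.  The coordinates
   of a section in that frame are not smooth on all of [M], but they are after a
   second multiplication by [b], whence the factor [b * b]. *)
Lemma local_frame i x : vdom i x ->
  exists (b : smoothfun M) (eps : 'I_(vrank E) -> Gamma E),
  [/\ b x != 0, forall y, b y != 0 -> vdom i y,
      forall y, vdom i y -> forall k, vtriv i y (eps k y) = b y *: delta_mx 0 k &
      forall e : Gamma E, exists2 s : 'I_(vrank E) -> smoothfun M,
        (forall k y, s k y = b y * (vtriv i y (e y)) 0 k) &
        (b * b) *: e = \sum_k s k *: eps k].
Proof.
move=> ix; have oi := vdom_open (v := E) i.
have [b [K [bx cK Ki b0]]] := bump_exists oi ix.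
pose eps k : Gamma E :=
  GammaSec (cutoff_smooth_sec oi cK Ki b0 (@vframe_smooth i k)).
have boff y : ~ vdom i y -> b y = 0 by move=> niy; apply: (b0) => /Ki.
have epsE y : vdom i y -> forall k, vtriv i y (eps k y) = b y *: delta_mx 0 k.
  by move=> iy k; rewrite linearZ /= vframeE.
exists b, eps; split=> // [y by0|e].
  by apply: contrapT => niy; move: by0; rewrite (boff _ niy) eqxx.
have sm k : smooth_on setT (fun y => b y * (vtriv i y (e y)) 0 k).
  apply: (cutoff_smooth oi cK Ki b0 openT); exact: (gamma_smooth e).
exists (fun k => mk_smoothfun (sm k)) => //.
apply: gammaP => y; rewrite gammaZE gamma_sumE smoothfunME -scalerA.
have [iy|niy] := pselect (vdom i y); last first.
  rewrite (boff _ niy) scale0r big1 // => k _.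
  by rewrite gammaZE /= (boff _ niy) mul0r scale0r.
rewrite (frame_decomp iy (epsE _ iy) (e y)) scaler_sumr; apply: eq_bigr => k _.
by rewrite gammaZE scalerA.
Qed.

Lemma section_through x (v : E x) : exists e : Gamma E, e x = v.
Proof.
have [i ix] := vdom_cover E x.
have [b [eps [bx _ epsE _]]] := local_frame ix.
exists (\sum_k cst_smoothfun M ((b x)^-1 * (vtriv i x v) 0 k) *: eps k).
rewrite gamma_sumE; apply: (can_inj (scalerK bx)).
rewrite (frame_decomp ix (epsE _ ix) v) scaler_sumr; apply: eq_bigr => k _.
by rewrite gammaZE scalerA /= mulrA divff // mul1r.
Qed.

Section Tensorial.
Context (F : Gamma E -> smoothfun M).
Hypothesis FL : forall f s t, F (f *: s + t) = f * F s + F t.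

Lemma tensor0 : F 0 = 0.
Proof.
have := FL 1 0 0; rewrite scaler0 addr0 mul1r => /eqP.
by rewrite -{1}[F 0]addr0 (inj_eq (addrI _)) => /eqP.
Qed.

Lemma tensorZ f s : F (f *: s) = f * F s.
Proof. by rewrite -[f *: s]addr0 FL tensor0 addr0. Qed.

Lemma tensorD s t : F (s + t) = F s + F t.
Proof. by rewrite -[s]scale1r FL mul1r scale1r. Qed.

Lemma tensor_sum n (s : 'I_n -> Gamma E) : F (\sum_k s k) = \sum_k F (s k).
Proof. exact: (big_morph F tensorD tensor0). Qed.

(** By [local_frame], a section vanishing at [x] is, up to the factor [b * b], a
   combination of global sections with coefficients that vanish at [x], and
   [F] commutes with such combinations. *)
Lemma tensor_local (e e' : Gamma E) x : e x = e' x -> F e x = F e' x.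
Proof.
suff Fx0 (s : Gamma E) : s x = 0 -> F s x = 0.
  move=> ex; have := Fx0 (e - e'); rewrite !gammaE ex subrr => /(_ erefl).
  by rewrite -scaleN1r addrC FL !smoothfunE mulN1r addrC => /eqP; rewrite subr_eq0 => /eqP.
move=> sx0; have [i ix] := vdom_cover E x.
have [b [eps [bx _ _ dec]]] := local_frame ix; have [c cE De] := dec s.
have : b x * b x * F s x = 0.
  rewrite -[LHS]/(((b * b) * F s) x) -tensorZ De tensor_sum.
  rewrite -[LHS]/(eval_at x _) rmorph_sum big1 // => k _.
  by rewrite tensorZ [LHS]smoothfunME cE sx0 linear0 mxE mulr0 mul0r.
by move/eqP; rewrite !mulf_eq0 orbb (negPf bx) => /eqP.
Qed.

End Tensorial.
End Frames.

(** * Representation of linear forms by sections *)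

Section Riesz.
Context {R : realType} {M : manifold R} (E : pe_bundle M).

Section Fiber.
Context (x : M).
Implicit Types u v w : E x.

Lemma pe_metricDl u v w : pe_metric (u + v) w = pe_metric u w + pe_metric v w.
Proof. by rewrite -[u in LHS]scale1r pe_linear mul1r. Qed.

Lemma pe_metric0l w : pe_metric (0 : E x) w = 0.
Proof. by rewrite pe_sym pe_metric0. Qed.

Lemma pe_metricZl a u w : pe_metric (a *: u) w = a * pe_metric u w.
Proof. by rewrite -[a *: u]addr0 pe_linear pe_metric0l addr0. Qed.

Lemma pe_metricNl u w : pe_metric (- u) w = - pe_metric u w.
Proof. by rewrite -scaleN1r pe_metricZl mulN1r. Qed.

Lemma pe_metricZr a u w : pe_metric u (a *: w) = a * pe_metric u w.
Proof. by rewrite pe_sym pe_metricZl (pe_sym u). Qed.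

Lemma pe_metric_suml n (u : 'I_n -> E x) w :
  pe_metric (\sum_k u k) w = \sum_k pe_metric (u k) w.
Proof.
by apply: (big_morph (fun u => pe_metric u w)) => [? ?|];
  [exact: pe_metricDl|exact: pe_metric0l].
Qed.

Lemma pe_inj u v : (forall w, pe_metric u w = pe_metric v w) -> u = v.
Proof.
move=> uv; apply/eqP; rewrite -subr_eq0; apply/eqP/pe_nondeg => w.
by rewrite pe_metricDl pe_metricNl uv subrr.
Qed.

(** A row vector in the kernel of the Gram matrix is the coordinate vector of a
   vector orthogonal to the whole fiber. *)
Lemma gram_det_neq0 i (b : R) (u : 'I_(vrank E) -> E x) : vdom i x -> b != 0 ->
  (forall k, vtriv i x (u k) = b *: delta_mx 0 k) ->
  \det (\matrix_(k, l) pe_metric (u k) (u l)) != 0.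
Proof.
move=> ix b0 uE; apply/det0P => -[w w0 wG].
move/eqP: w0; apply; pose v := \sum_k w 0 k *: u k.
have vE : vtriv i x v = b *: w.
  rewrite linear_sum [w in RHS]row_sum_delta scaler_sumr; apply: eq_bigr => k _.
  by rewrite [LHS]linearZ /= uE !scalerA mulrC.
suff v0 : v = 0.
  by move: vE; rewrite v0 linear0 => /esym/eqP; rewrite scaler_eq0 (negPf b0) => /eqP.
apply: pe_nondeg => z; apply: (mulfI b0); rewrite mulr0 -pe_metricZr.
rewrite (frame_decomp ix uE z) pe_sym pe_metric_suml big1 // => l _.
rewrite pe_metricZl pe_sym pe_metric_suml.
have := congr1 (fun m : 'rV_ _ => m 0 l) wG; rewrite !mxE => wl.
rewrite (_ : \sum_k _ = 0) ?mulr0 // -[RHS]wl; apply: eq_bigr => k _.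
by rewrite pe_metricZl mxE.
Qed.

Lemma pe_riesz (alpha : E x -> R) :
  (forall a u v, alpha (a *: u + v) = a * alpha u + alpha v) ->
  exists u, forall v, pe_metric u v = alpha v.
Proof.
move=> al.
have aD u v : alpha (u + v) = alpha u + alpha v.
  by rewrite -[u in LHS]scale1r al mul1r.
have a0 : alpha 0 = 0 by apply: (addrI (alpha 0)); rewrite -aD !addr0.
have aZ a u : alpha (a *: u) = a * alpha u.
  by rewrite -[a *: u]addr0 al a0 addr0.
have [i ix] := vdom_cover E x.
pose f k : E x := vframe i k x.
have fE k : vtriv i x (f k) = 1 *: delta_mx 0 k by rewrite vframeE // scale1r.
pose G := \matrix_(k, l) pe_metric (f k) (f l).
have Gu : G \in unitmx by rewrite unitmxE unitfE (gram_det_neq0 ix (oner_neq0 R)).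
pose w := (\row_k alpha (f k)) *m invmx G.
exists (\sum_k w 0 k *: f k) => v.
rewrite -[v]scale1r (frame_decomp ix fE v) (big_morph alpha aD a0) pe_sym.
rewrite pe_metric_suml; apply: eq_bigr => l _.
rewrite pe_metricZl aZ pe_sym pe_metric_suml; congr (_ * _).
have : (w *m G) 0 l = alpha (f l) by rewrite mulmxKV // mxE.
move=> <-; rewrite [RHS]mxE; apply: eq_bigr => k _.
by rewrite pe_metricZl [G k l]mxE.
Qed.

End Fiber.

Lemma pe_inner_inj (s t : Gamma E) :
  (forall e, pe_inner s e = pe_inner t e) -> s = t.
Proof.
move=> st; apply: gammaP => x; apply: pe_inj => v.
by have [e <-] := section_through v; have := congr1 (fun f : smoothfun M => f x) (st e).
Qed.

(** Pointwise, [F] is a linear form on the fiber by tensoriality, and it is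
   represented by non-degeneracy.  The representing vectors vary smoothly since,
   in a local frame, Cramer's rule expresses their coordinates with the adjugate
   and the inverse determinant of the Gram matrix. *)
Lemma section_riesz (F : Gamma E -> smoothfun M) :
  (forall f s t, F (f *: s + t) = f * F s + F t) ->
  exists s : Gamma E, forall e, pe_inner s e = F e.
Proof.
move=> FL.
have ptw x : exists u : E x, forall e : Gamma E, pe_metric u (e x) = F e x.
  have [ext extE] := choice (@section_through _ _ E x).
  have [|u uE] := @pe_riesz x (fun v => F (ext v) x); last first.
    exists u => e; rewrite uE; apply: (tensor_local FL); exact: extE.
  move=> a u v; rewrite -[RHS]/((cst_smoothfun M a * F (ext u) + F (ext v)) x).
  rewrite -FL; apply: (tensor_local FL); rewrite !gammaE !extE //.
pose s x := projT1 (cid (ptw x)).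
have sE x : forall e : Gamma E, pe_metric (s x) (e x) = F e x.
  exact: (projT2 (cid (ptw x))).
suff ss : smooth_sec (F := E) setT s.
  exists (GammaSec ss) => e; apply: smoothfunP => x; exact: sE.
move=> i k; apply: smooth_on_local => x [_ ix].
have [b [eps [bx bi epsE _]]] := local_frame ix.
pose G : 'M[smoothfun M]_(vrank E) := \matrix_(k, l) pe_inner (eps k) (eps l).
pose phi : 'rV[smoothfun M]_(vrank E) := \row_l (b * F (eps l)).
have detE y : (\det G) y = \det (\matrix_(k, l) pe_metric (eps k y) (eps l y)).
  rewrite -[LHS]/(eval_at y _) -det_map_mx; congr (\det _).
  by apply/matrixP => ? ?; rewrite !mxE.
exists [set y | b y != 0] => //.
have oV := open_smoothfun_neq0 b.
have G0 y : b y != 0 -> (\det G) y != 0.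
  by move=> by0; rewrite detE (gram_det_neq0 (bi _ by0) by0) // => l; by apply: epsE; exact: bi.
apply: (@smooth_on_ext _ _ _
    (fun y => (phi *m \adj G) 0 k y * ((\det G) y)^-1)).
- exact: oV.
- move=> y by0; have iy := bi _ by0; apply: (mulIf (G0 _ by0)).
  rewrite mulfVK ?G0 // -[RHS]/(vtriv i y (s y) 0 k * (\det G) y).
  have phiE : map_mx (eval_at y) phi =
      vtriv i y (s y) *m map_mx (eval_at y) G.
    apply/rowP => l; rewrite !mxE [LHS]smoothfunME -sE -pe_metricZl.
    rewrite (frame_decomp iy (epsE _ iy) (s y)) pe_metric_suml.
    by apply: eq_bigr => m _; rewrite pe_metricZl !mxE.
  transitivity (map_mx (eval_at y) (phi *m \adj G) 0 k); first by rewrite [RHS]mxE.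
  rewrite map_mxM phiE map_mx_adj -mulmxA mul_mx_adj mul_mx_scalar mxE mulrC.
  by rewrite det_map_mx.
apply: smooth_onM; [exact: oV|exact: smoothfun_smooth|].
by apply: smooth_on_inv oV _ G0; exact: smoothfun_smooth.
Qed.

End Riesz.

(** * Algebra of vector fields, inner products and gradients *)

Section VectorFields.
Context {R : realType} {M : manifold R}.
Implicit Types (X Y : Gamma (TM M)) (f h : smoothfun M).

Lemma cst_smoothfun1 : cst_smoothfun M 1 = 1.
Proof. exact: smoothfunP. Qed.

Lemma vactD X f h : vact X (f + h) = vact X f + vact X h.
Proof.
apply: smoothfunP => x; rewrite smoothfunDE /=.
by have := proj1 (tangentP (X x)) 1 f h; rewrite scale1r mul1r.
Qed.

Lemma vactZ X a f : vact X (cst_smoothfun M a * f) = cst_smoothfun M a * vact X f.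
Proof.
apply: smoothfunP => x; rewrite smoothfunME /=.
have := proj1 (tangentP (X x)) a f 0; rewrite addr0 => ->.
have := proj1 (tangentP (X x)) 0 0 0; rewrite scale0r addr0 mul0r add0r => X0.
have := proj1 (tangentP (X x)) 1 0 0; rewrite scale1r addr0 mul1r => /eqP.
by rewrite -{1}[X x 0]addr0 (inj_eq (addrI _)) => /eqP <-; rewrite addr0.
Qed.

Lemma vactN X f : vact X (- f) = - vact X f.
Proof.
have E h : - h = cst_smoothfun M (-1) * h.
  by apply: smoothfunP => x; rewrite [RHS]mulN1r.
by rewrite !E vactZ.
Qed.

Lemma vact_cst X a : vact X (cst_smoothfun M a) = 0.
Proof.
suff X1 : vact X 1 = 0.
  by rewrite -[cst_smoothfun M a]mulr1 vactZ X1 mulr0.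
apply: smoothfunP => x; have := proj2 (tangentP (X x)) 1 1.
rewrite mulr1 mul1r /= => /eqP; rewrite [_ * 1]mulr1.
by rewrite -{1}[X x 1]addr0 (inj_eq (addrI _)) => /eqP <-.
Qed.

Lemma vactDl X Y f : vact (X + Y) f = vact X f + vact Y f.
Proof. by apply: smoothfunP => x; rewrite -[LHS]/((X + Y) x f) gammaDE. Qed.

Lemma vactZl h X f : vact (h *: X) f = h * vact X f.
Proof. by apply: smoothfunP => x; rewrite -[LHS]/((h *: X) x f) gammaZE. Qed.

Lemma vact0l f : vact 0 f = 0.
Proof. exact: smoothfunP. Qed.

(** The differential of [f] at [x]; these are the linear forms to which the
   isotropy condition is applied. *)
Definition tangent_eval (x : M) f (v : tangent x) : R^o := v f.

Fact tangent_eval_scalar x f : scalar (@tangent_eval x f).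
Proof. by []. Qed.

HB.instance Definition _ x f := GRing.isLinear.Build R (tangent x) R^o *%R
  (@tangent_eval x f) (@tangent_eval_scalar x f).

Lemma vf_eq0 X : (forall f, vact X f = 0) -> X = 0.
Proof.
move=> X0; apply: gammaP => x; apply/val_inj/funext => f.
exact: (congr1 (fun h : smoothfun M => h x) (X0 f)).
Qed.

End VectorFields.

Section Inner.
Context {R : realType} {M : manifold R} {E : pe_bundle M}.
Implicit Types (s t u : Gamma E) (f : smoothfun M).

Lemma pe_innerC s t : pe_inner s t = pe_inner t s.
Proof. by apply: smoothfunP => x; exact: pe_sym. Qed.

Lemma pe_inner_at s t x : pe_inner s t x = pe_metric (s x) (t x).
Proof. by []. Qed.

Lemma pe_innerDl s t u : pe_inner (s + t) u = pe_inner s u + pe_inner t u.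
Proof. by apply: smoothfunP => x; rewrite pe_inner_at gammaDE pe_metricDl. Qed.

Lemma pe_innerNl s u : pe_inner (- s) u = - pe_inner s u.
Proof. by apply: smoothfunP => x; rewrite pe_inner_at gammaNE pe_metricNl. Qed.

Lemma pe_innerZl f s u : pe_inner (f *: s) u = f * pe_inner s u.
Proof. by apply: smoothfunP => x; rewrite pe_inner_at gammaZE pe_metricZl. Qed.

Lemma pe_inner0l u : pe_inner 0 u = 0.
Proof. by rewrite -[0](scale0r u) pe_innerZl mul0r. Qed.

Lemma pe_innerDr s t u : pe_inner u (s + t) = pe_inner u s + pe_inner u t.
Proof. by rewrite pe_innerC pe_innerDl !(pe_innerC u). Qed.

Lemma pe_innerNr s u : pe_inner u (- s) = - pe_inner u s.
Proof. by rewrite pe_innerC pe_innerNl (pe_innerC u). Qed.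

Lemma pe_innerZr f s u : pe_inner u (f *: s) = f * pe_inner u s.
Proof. by rewrite pe_innerC pe_innerZl (pe_innerC u). Qed.

Lemma pe_inner0r u : pe_inner u 0 = 0.
Proof. by rewrite pe_innerC pe_inner0l. Qed.

End Inner.

Definition pe_innerE := (@pe_innerDl, @pe_innerNl, @pe_innerZl, @pe_inner0l,
  @pe_innerDr, @pe_innerNr, @pe_innerZr, @pe_inner0r).

Section Gradient.
Context {R : realType} {M : manifold R} (E : pe_bundle M).
Context (rho : bundle_map E (TM M)).
Implicit Types (e s t : Gamma E) (f h : smoothfun M).

Lemma bmap_secP f s t :
  bmap_sec rho (f *: s + t) = f *: bmap_sec rho s + bmap_sec rho t.
Proof. by apply: gammaP => x; rewrite -[LHS]/(rho x ((f *: s + t) x)) !gammaE linearP. Qed.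

Lemma bmap_sec0 : bmap_sec rho 0 = 0.
Proof. by apply: gammaP => x; rewrite /= linear0. Qed.

Lemma bmap_secD s t : bmap_sec rho (s + t) = bmap_sec rho s + bmap_sec rho t.
Proof. by rewrite -[s in LHS]scale1r bmap_secP scale1r. Qed.

Lemma bmap_secN s : bmap_sec rho (- s) = - bmap_sec rho s.
Proof. by rewrite -scaleN1r -[_ *: _]addr0 bmap_secP bmap_sec0 addr0 scaleN1r. Qed.

Fact grad_exists f : exists s, forall e,
  pe_inner s e = cst_smoothfun M 2^-1 * vact (bmap_sec rho e) f.
Proof.
apply: section_riesz => h s t.
by rewrite bmap_secP vactDl vactZl mulrDr mulrCA.
Qed.

(** A global section, unlike the pointwise [courant_d rho f]: it can be anchored to
   a vector field along which [nabla] differentiates. *)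
Definition grad f : Gamma E := projT1 (cid (grad_exists f)).

Lemma gradE f e :
  pe_inner (grad f) e = cst_smoothfun M 2^-1 * vact (bmap_sec rho e) f.
Proof. exact: projT2 (cid (grad_exists f)) e. Qed.

Lemma gradD f h : grad (f + h) = grad f + grad h.
Proof. by apply: pe_inner_inj => e; rewrite pe_innerDl !gradE vactD mulrDr. Qed.

Lemma courant_d_atE x (alpha : {scalar tangent x}) v :
  pe_metric (courant_d_at rho alpha) v = 2^-1 * alpha (rho x v).
Proof.
rewrite /courant_d_at pe_metricZl /sharp; congr (_ * _).
case: xgetP => [_ _ //|H].
have [|u uE] := @pe_riesz _ _ E x (fun z => alpha (rho x z)).
  by move=> a u w; rewrite !linearP.
by case: (H u).
Qed.

Lemma courant_dE f x : courant_d rho f x = grad f x.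
Proof.
apply: pe_inj => v; have [e <-] := section_through v.
rewrite (courant_d_atE (@tangent_eval _ _ x f)).
by have /(congr1 (fun h : smoothfun M => h x)) := gradE f e.
Qed.

(** The isotropy of the image of [courant_d_at] says that [(rho (grad f)) h], twice
   the inner product of two gradients, vanishes. *)
Lemma anchor_grad : courant_vb rho -> forall f, bmap_sec rho (grad f) = 0.
Proof.
move=> [_ iso] f; apply: vf_eq0 => h; apply: smoothfunP => x.
have := iso x (@tangent_eval _ _ x h) (@tangent_eval _ _ x f).
rewrite courant_d_atE => /eqP; rewrite mulf_eq0 invr_eq0 pnatr_eq0 /= => /eqP.
by rewrite -[courant_d_at _ _]/(courant_d rho f x) courant_dE.
Qed.

Section Bracket.
Context (br : Gamma E -> Gamma E -> Gamma E).

Section Skew.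
Context (skew : skew_bracket br).

Lemma br_skew e1 e2 : br e1 e2 = - br e2 e1.
Proof. by have [-> _] := skew. Qed.

Lemma br_lin a e1 e2 e3 : br (cst_smoothfun M a *: e1 + e2) e3 =
  cst_smoothfun M a *: br e1 e3 + br e2 e3.
Proof. by have [_ ->] := skew. Qed.

Lemma brDl e1 e2 e : br (e1 + e2) e = br e1 e + br e2 e.
Proof. by have := br_lin 1 e1 e2 e; rewrite cst_smoothfun1 !scale1r. Qed.

Lemma br0l e : br 0 e = 0.
Proof. by apply: (addrI (br 0 e)); rewrite -brDl !addr0. Qed.

Lemma br0r e : br e 0 = 0.
Proof. by rewrite br_skew br0l oppr0. Qed.

Lemma brNl e1 e : br (- e1) e = - br e1 e.
Proof. by apply: (addrI (br e1 e)); rewrite -brDl !subrr br0l. Qed.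

End Skew.

Definition bracket_metric := forall e e1 e2,
  vact (bmap_sec rho e) (pe_inner e1 e2) =
  pe_inner (br e e1 + grad (pe_inner e e1)) e2 +
  pe_inner e1 (br e e2 + grad (pe_inner e e2)).

Lemma pre_courantE : pre_courant rho br <->
  [/\ courant_vb rho, skew_bracket br,
      forall e1 e2,
        bmap_sec rho (br e1 e2) = lie (bmap_sec rho e1) (bmap_sec rho e2) &
      bracket_metric].
Proof.
split=> -[h1 h2 h3 h4]; split=> // e e1 e2.
  by apply: smoothfunP => x; rewrite h4 smoothfunDE !pe_inner_at !gammaDE !courant_dE.
by move=> x; rewrite h4 smoothfunDE !pe_inner_at !gammaDE !courant_dE.
Qed.

Definition jacobiator e1 e2 e3 :=
  br (br e1 e2) e3 + br (br e2 e3) e1 + br (br e3 e1) e2.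

Definition jacobi_potential e1 e2 e3 := pe_inner (br e1 e2) e3 +
  pe_inner (br e2 e3) e1 + pe_inner (br e3 e1) e2.

Lemma courantE : courant rho br <-> pre_courant rho br /\
  forall e1 e2 e3, jacobiator e1 e2 e3 =
    cst_smoothfun M 3^-1 *: grad (jacobi_potential e1 e2 e3).
Proof.
split=> -[h1 h2]; split=> // e1 e2 e3.
  by apply: gammaP => x; rewrite !gammaDE h2 gammaZE courant_dE.
move=> x; rewrite -!gammaDE -/(jacobiator e1 e2 e3) h2 gammaZE.
by rewrite courant_dE.
Qed.

End Bracket.
End Gradient.

(** * Connections *)

Section Connection.
Context {R : realType} {M : manifold R} {C : pe_bundle M}.
Context {nabla : Gamma (TM M) -> Gamma C -> Gamma C}.
Context (conn : connection nabla).
Implicit Types (X Y : Gamma (TM M)) (c d : Gamma C).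

Lemma nabla0 X : nabla X 0 = 0.
Proof.
have [_ nD _] := conn.
by apply: (addrI (nabla X 0)); rewrite -nD !addr0.
Qed.

Lemma nablaN X c : nabla X (- c) = - nabla X c.
Proof.
have [_ nD _] := conn.
by apply: (addrI (nabla X c)); rewrite -nD !subrr nabla0.
Qed.

Lemma nablaD X c d : nabla X (c + d) = nabla X c + nabla X d.
Proof. by have [_ nD _] := conn. Qed.

Lemma nablaZ X a c :
  nabla X (cst_smoothfun M a *: c) = cst_smoothfun M a *: nabla X c.
Proof. by have [_ _ ->] := conn; rewrite vact_cst scale0r add0r. Qed.

Lemma nablaP f X Y c : nabla (f *: X + Y) c = f *: nabla X c + nabla Y c.
Proof. by have [-> _ _] := conn. Qed.

Lemma nabla0l c : nabla 0 c = 0.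
Proof.
apply: (addrI (nabla 0 c)).
by rewrite addr0 -{3}[0]addr0 -{3}(scale1r 0) nablaP scale1r.
Qed.

End Connection.

(** * Sections of a direct sum *)

Section DirectSum.
Context {R : realType} {M : manifold R} {E C : pe_bundle M}.
Context {rho : bundle_map E (TM M)}.
Local Notation EC := (pe_dsum E C).
Local Notation rhoEC := (dsum_map C rho : bundle_map EC (TM M)).
Implicit Types (e : Gamma E) (c : Gamma C) (s t : Gamma EC) (f : smoothfun M).

Lemma secP s t : sec_fst s = sec_fst t -> sec_snd s = sec_snd t -> s = t.
Proof.
move=> st1 st2; apply: gammaP => x.
have := congr1 (fun e : Gamma E => e x) st1.
have := congr1 (fun c : Gamma C => c x) st2.
by rewrite /=; case: (s x) (t x) => [a b] [a' b'] /= -> ->.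
Qed.

Lemma sec_fst_pair e c : sec_fst (sec_pair e c) = e.
Proof. exact: gammaP. Qed.

Lemma sec_snd_pair e c : sec_snd (sec_pair e c) = c.
Proof. exact: gammaP. Qed.

Lemma sec_fstD s t : sec_fst (s + t) = sec_fst s + sec_fst t.
Proof. by apply: gammaP => x; rewrite gammaDE -[LHS]/(((s + t) x).1) gammaDE. Qed.

Lemma sec_sndD s t : sec_snd (s + t) = sec_snd s + sec_snd t.
Proof. by apply: gammaP => x; rewrite gammaDE -[LHS]/(((s + t) x).2) gammaDE. Qed.

Lemma sec_fstZ f s : sec_fst (f *: s) = f *: sec_fst s.
Proof. by apply: gammaP => x; rewrite gammaZE -[LHS]/(((f *: s) x).1) gammaZE. Qed.

Lemma sec_sndZ f s : sec_snd (f *: s) = f *: sec_snd s.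
Proof. by apply: gammaP => x; rewrite gammaZE -[LHS]/(((f *: s) x).2) gammaZE. Qed.

Lemma sec_fstN s : sec_fst (- s) = - sec_fst s.
Proof. by rewrite -scaleN1r sec_fstZ scaleN1r. Qed.

Lemma sec_sndN s : sec_snd (- s) = - sec_snd s.
Proof. by rewrite -scaleN1r sec_sndZ scaleN1r. Qed.

Lemma dsum_inner s t : pe_inner s t =
  pe_inner (sec_fst s) (sec_fst t) + pe_inner (sec_snd s) (sec_snd t).
Proof. exact: smoothfunP. Qed.

Lemma dsum_anchor s : bmap_sec rhoEC s = bmap_sec rho (sec_fst s).
Proof. exact: gammaP. Qed.

Lemma dsum_grad f : grad rhoEC f = sec_pair (grad rho f) 0.
Proof.
apply: pe_inner_inj => s; rewrite gradE dsum_anchor dsum_inner.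
by rewrite sec_fst_pair sec_snd_pair pe_innerE addr0 gradE.
Qed.

Lemma dsum_courant_d_at x (alpha : {scalar tangent x}) :
  courant_d_at rhoEC alpha = (courant_d_at rho alpha, 0).
Proof.
apply: pe_inj => v; rewrite courant_d_atE -[LHS]/(2^-1 * alpha (rho x v.1)).
by rewrite -[RHS]/(pe_metric _ _ + pe_metric _ _) /= courant_d_atE pe_metric0l addr0.
Qed.

(** The zero anchor on [C] changes neither the distribution nor, up to a null
   [C]-component, the image of [courant_d_at]. *)
Lemma dsum_courant_vb : courant_vb rho -> courant_vb rhoEC.
Proof.
move=> [fol iso]; split=> [|x alpha beta].
  suff -> : (fun x => range (rhoEC x)) = (fun x => range (rho x)) by [].
  apply: functional_extensionality_dep => x; apply/seteqP; split=> _ [v _ <-].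
    by exists v.1.
  by exists (v, 0).
rewrite !dsum_courant_d_at -[LHS]/(pe_metric _ _ + pe_metric _ _) /=.
by rewrite iso pe_metric0 addr0.
Qed.

End DirectSum.

(** * The extended bracket *)

Section Extension.
Context {R : realType} {M : manifold R} {E C : pe_bundle M}.
Context {rho : bundle_map E (TM M)} {br : Gamma E -> Gamma E -> Gamma E}.
Context {nabla : Gamma (TM M) -> Gamma C -> Gamma C}.
Context (metr : metric_connection nabla).
Local Notation conn := (proj1 metr).
Local Notation half := (cst_smoothfun M 2^-1).
Local Notation "∇ e" := (nabla (bmap_sec rho e)) (at level 10, e at level 9).
Implicit Types (e : Gamma E) (c d : Gamma C).

Lemma nabla_metric e c d : vact (bmap_sec rho e) (pe_inner c d) =
  pe_inner (∇ e c) d + pe_inner c (∇ e d).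
Proof. exact: (proj2 metr). Qed.

Lemma nabla_anchorP f e1 e2 c : ∇ (f *: e1 + e2) c = f *: ∇ e1 c + ∇ e2 c.
Proof. by rewrite bmap_secP (nablaP conn). Qed.

Fact gamma0_exists c1 c2 : exists s : Gamma E, forall e, pe_inner s e =
  half * (pe_inner c1 (∇ e c2) - pe_inner c2 (∇ e c1)).
Proof.
apply: section_riesz => f s t; rewrite !nabla_anchorP !pe_innerE.
by rewrite [_ * (half * _)]mulrCA -mulrDr [_ * (_ - pe_inner _ _)]mulrBr opprD addrACA.
Qed.

Lemma gamma0_unique : exists! gamma0, is_gamma0 rho nabla gamma0.
Proof.
exists (fun c1 c2 => projT1 (cid (gamma0_exists c1 c2))); split=> [c1 c2 e|g gP].
  exact: projT2 (cid (gamma0_exists c1 c2)) e.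
apply/funext => c1; apply/funext => c2; apply: pe_inner_inj => e.
by rewrite gP; exact: projT2 (cid (gamma0_exists c1 c2)) e.
Qed.

Context {gamma0 : Gamma C -> Gamma C -> Gamma E}.
Context (g0 : is_gamma0 rho nabla gamma0).

Lemma gamma0_skew c1 c2 : gamma0 c1 c2 = - gamma0 c2 c1.
Proof.
by apply: pe_inner_inj => e; rewrite pe_innerNl !g0 -mulrN opprB.
Qed.

Lemma gamma0_linear a c1 c2 c3 : gamma0 (cst_smoothfun M a *: c1 + c2) c3 =
  cst_smoothfun M a *: gamma0 c1 c3 + gamma0 c2 c3.
Proof.
apply: pe_inner_inj => e; rewrite !(pe_innerE, g0).
rewrite (nablaD conn) (nablaZ conn) !pe_innerE.
by rewrite [_ * (half * _)]mulrCA -mulrDr [_ * (_ - pe_inner _ _)]mulrBr opprD addrACA.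
Qed.

Lemma gamma0D c1 c2 c3 : gamma0 (c1 + c2) c3 = gamma0 c1 c3 + gamma0 c2 c3.
Proof.
by have := gamma0_linear 1 c1 c2 c3; rewrite cst_smoothfun1 !scale1r.
Qed.

Lemma gamma0_0l c : gamma0 0 c = 0.
Proof.
by apply: pe_inner_inj => e; rewrite g0 (nabla0 conn) !pe_innerE subrr mulr0.
Qed.

Lemma gamma0_0r c : gamma0 c 0 = 0.
Proof. by rewrite gamma0_skew gamma0_0l oppr0. Qed.

Lemma gamma0N c1 c2 : gamma0 (- c1) c2 = - gamma0 c1 c2.
Proof. by apply: (addrI (gamma0 c1 c2)); rewrite -gamma0D !subrr gamma0_0l. Qed.

Context (Epre : pre_courant rho br).

(** The vector field [rho (gamma0 c1 c2)] acts on [f] by twice the inner product of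
   [gamma0 c1 c2] with [grad rho f], which involves [nabla] only along the zero
   field [rho (grad rho f)]. *)
Lemma anchor_gamma0 c1 c2 : bmap_sec rho (gamma0 c1 c2) = 0.
Proof.
have [cv _ _ _] := Epre.
apply: vf_eq0 => f; have := g0 c1 c2 (grad rho f).
rewrite pe_innerC gradE (anchor_grad cv) !(nabla0l conn) !pe_innerE subrr mulr0.
move=> z; apply: smoothfunP => x; have := congr1 (fun h : smoothfun M => h x) z.
by move/eqP; rewrite smoothfunME mulf_eq0 invr_eq0 pnatr_eq0 /= => /eqP.
Qed.

Let skew : skew_bracket br.
Proof. by have [_ ? _ _] := Epre. Qed.

Let anchor_br e1 e2 :
  bmap_sec rho (br e1 e2) = lie (bmap_sec rho e1) (bmap_sec rho e2).
Proof. by have [_ _ -> _] := Epre. Qed.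

Let br_metric : bracket_metric rho br.
Proof. by have /pre_courantE[] := Epre. Qed.

Local Notation EC := (pe_dsum E C).
Local Notation rhoEC := (dsum_map C rho : bundle_map EC (TM M)).
Local Notation brEC := (dsum_bracket rho br nabla gamma0).
Implicit Types (s t : Gamma EC).

Lemma dsum_br_fst s t : sec_fst (brEC s t) =
  br (sec_fst s) (sec_fst t) - gamma0 (sec_snd s) (sec_snd t).
Proof. exact: sec_fst_pair. Qed.

Lemma dsum_br_snd s t : sec_snd (brEC s t) =
  ∇ (sec_fst s) (sec_snd t) - ∇ (sec_fst t) (sec_snd s).
Proof. exact: sec_snd_pair. Qed.

Lemma dsum_skew : skew_bracket brEC.
Proof.
split=> [s t|a s t u].
  by apply: secP; rewrite ?(sec_fstN, sec_sndN, dsum_br_fst, dsum_br_snd) opprB;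
    rewrite // (br_skew skew) gamma0_skew opprK addrC.
apply: secP.
  rewrite !(sec_fstD, sec_fstZ, dsum_br_fst, sec_sndD, sec_sndZ) (br_lin skew) gamma0_linear.
  by rewrite scalerBr opprD addrACA.
rewrite !(sec_fstD, sec_fstZ, dsum_br_snd, sec_sndD, sec_sndZ) nabla_anchorP.
by rewrite (nablaD conn) (nablaZ conn) scalerBr opprD addrACA.
Qed.

Lemma dsum_anchor_br s t : bmap_sec rhoEC (brEC s t) =
  lie (bmap_sec rhoEC s) (bmap_sec rhoEC t).
Proof.
rewrite !dsum_anchor dsum_br_fst bmap_secD bmap_secN anchor_gamma0 subr0.
exact: anchor_br.
Qed.

Lemma dsum_metric_br : bracket_metric rhoEC brEC.
Proof.
move=> s s1 s2; rewrite !dsum_inner !dsum_grad dsum_anchor !(sec_fstD, sec_sndD).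
rewrite !(dsum_br_fst, dsum_br_snd, sec_fst_pair, sec_snd_pair) addr0.
move: (sec_fst s) (sec_fst s1) (sec_fst s2) (sec_snd s) (sec_snd s1) (sec_snd s2).
move=> e e1 e2 c c1 c2; rewrite !vactD !gradD br_metric.
rewrite !(pe_innerE, gradE, g0) (pe_innerC e1 (gamma0 c c2)).
rewrite (pe_innerC e1 (grad _ (pe_inner c c2))) !g0 !gradE !nabla_metric.
rewrite (pe_innerC (∇ e2 c) c1) (pe_innerC (∇ e1 c) c2).
by apply: smoothfunP => x; rewrite !smoothfunE /=; lra.
Qed.

Lemma dsum_pre_courant : pre_courant rhoEC brEC.
Proof.
apply/pre_courantE; split; [by apply: dsum_courant_vb; case: Epre|exact: dsum_skew|
  exact: dsum_anchor_br|exact: dsum_metric_br].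
Qed.

(** Gradients have no component in [C], so the cyclic sum of curvatures has to
   vanish when the Courant axiom holds.  The sections [gamma0 _ _] occurring inside
   the double brackets disappear because the anchor kills them. *)
Lemma dsum_jacobiator_snd s1 s2 s3 : sec_snd (jacobiator brEC s1 s2 s3) =
  - (curvature nabla (bmap_sec rhoEC s1) (bmap_sec rhoEC s2) (sec_snd s3) +
     curvature nabla (bmap_sec rhoEC s2) (bmap_sec rhoEC s3) (sec_snd s1) +
     curvature nabla (bmap_sec rhoEC s3) (bmap_sec rhoEC s1) (sec_snd s2)).
Proof.
rewrite !dsum_anchor !sec_sndD !dsum_br_snd !dsum_br_fst.
rewrite !bmap_secD !bmap_secN !anchor_gamma0 !subr0 !anchor_br /curvature.
move: (sec_fst s1) (sec_fst s2) (sec_fst s3) (sec_snd s1) (sec_snd s2) (sec_snd s3).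
move=> e1 e2 e3 c1 c2 c3; rewrite !(nablaD conn) !(nablaN conn).
apply: pe_inner_inj => d; rewrite !pe_innerE.
by apply: smoothfunP => x; rewrite !smoothfunE; lra.
Qed.

(** After pairing with [e], invariance of the inner product expresses
   [br (gamma0 c1 c2) e3] through the derivative of [pe_inner (gamma0 c1 c2) e]
   along [rho e3], up to a gradient and to [gamma0 c1 c2] paired with [br e3 e].
   Expanding that derivative by the metric property of [nabla], the second
   derivatives left over are commutators of [∇ e3] and [∇ e], which flatness
   identifies with [∇ (br e3 e)]. *)
Lemma br_gamma0 (flt : flat_along nabla (range (bmap_sec rho))) c1 c2 e3 :
  br (gamma0 c1 c2) e3 + gamma0 c1 (∇ e3 c2) + gamma0 (∇ e3 c1) c2 =
  grad rho (pe_inner (gamma0 c1 c2) e3).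
Proof.
apply: pe_inner_inj => e.
have comm c : ∇ e3 (∇ e c) = ∇ e (∇ e3 c) + ∇ (br e3 e) c.
  have := flt _ _ c (imageT (bmap_sec rho) e3) (imageT (bmap_sec rho) e).
  rewrite /curvature -anchor_br => /eqP; rewrite !subr_eq add0r => /eqP ->.
  by rewrite addrC.
have inv := br_metric e3 (gamma0 c1 c2) e.
have orth f : pe_inner (gamma0 c1 c2) (grad rho f) = 0.
  by rewrite pe_innerC gradE anchor_gamma0 vact0l mulr0.
rewrite pe_innerDr orth addr0 pe_innerDl gradE (pe_innerC e3) in inv.
rewrite (br_skew skew e3 (gamma0 c1 c2)) in inv; rewrite !pe_innerDl gradE.
move: (vact (bmap_sec rho e) _) inv => w.
rewrite !g0 vactZ vactD vactN !nabla_metric !comm !pe_innerE.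
rewrite (pe_innerC (∇ e3 c1) (∇ e c2)) (pe_innerC (∇ e3 c2) (∇ e c1)) => inv.
apply: smoothfunP => x; have := congr1 (fun h : smoothfun M => h x) inv.
rewrite !smoothfunE /=; lra.
Qed.

Lemma dsum_jacobi : courant rho br ->
  flat_along nabla (range (bmap_sec rho)) -> courant rhoEC brEC.
Proof.
move=> /courantE[_ jac] flt; apply/courantE; split; first exact: dsum_pre_courant.
move=> s1 s2 s3; rewrite dsum_grad; apply: secP; last first.
  rewrite dsum_jacobiator_snd sec_sndZ sec_snd_pair scaler0 !dsum_anchor.
  rewrite !flt; try by [exists (sec_fst s1)|exists (sec_fst s2)|exists (sec_fst s3)].
  by rewrite !addr0 oppr0.
rewrite sec_fstZ sec_fst_pair /jacobiator /jacobi_potential !sec_fstD !dsum_inner.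
rewrite !dsum_br_fst !dsum_br_snd.
move: (sec_fst s1) (sec_fst s2) (sec_fst s3) (sec_snd s1) (sec_snd s2) (sec_snd s3).
move=> e1 e2 e3 c1 c2 c3.
have := jac e1 e2 e3; rewrite /jacobiator /jacobi_potential => jacE.
have key c d e : br (gamma0 c d) e =
    grad rho (pe_inner (gamma0 c d) e) - gamma0 (∇ e c) d + gamma0 (∇ e d) c.
  by rewrite -br_gamma0 // (gamma0_skew c (∇ e d)) addrK subrK.
(* In the cyclic sum the terms gamma0 (∇ _ _) _ cancel.  Each inner product of
   gamma0 c d with e enters the argument of the gradient on the right three
   times, once by itself and twice through the pairings in C, which balances the
   factor one third. *)
rewrite !(brDl skew, brNl skew, gamma0D, gamma0N) !key.
apply: pe_inner_inj => e.
have := congr1 (fun z => pe_inner z e) jacE; rewrite !pe_innerE !gradE => {}jacE.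
rewrite (g0 c1 c2 e3) (g0 c2 c3 e1) (g0 c3 c1 e2).
rewrite (pe_innerC c1 (∇ e3 c2)) (pe_innerC c2 (∇ e3 c1)).
rewrite (pe_innerC c2 (∇ e1 c3)) (pe_innerC c3 (∇ e1 c2)).
rewrite (pe_innerC c3 (∇ e2 c1)) (pe_innerC c1 (∇ e2 c3)).
rewrite !(vactD, vactN, vactZ) in jacE *.
apply: smoothfunP => x; have := congr1 (fun h : smoothfun M => h x) jacE.
rewrite !smoothfunE /=; lra.
Qed.

(** Testing the Jacobi identity on two sections of [E] and one of [C] isolates a
   single curvature term. *)
Lemma dsum_courant : courant rho br ->
  courant rhoEC brEC <-> flat_along nabla (range (bmap_sec rho)).
Proof.
move=> Ec; split=> [|flt]; last exact: dsum_jacobi.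
move=> /courantE[_ jac] _ _ c [e1 _ <-] [e2 _ <-].
have := congr1 (@sec_snd _ _ _ _) (jac (sec_pair e1 0) (sec_pair e2 0) (sec_pair 0 c)).
rewrite dsum_grad sec_sndZ sec_snd_pair scaler0 dsum_jacobiator_snd.
rewrite !dsum_anchor !sec_fst_pair !sec_snd_pair /curvature.
by rewrite !(nabla0 conn) !subrr !addr0 => /eqP; rewrite oppr_eq0 => /eqP.
Qed.

End Extension.

Theorem proposition2p2 (R : realType) (M : manifold R)
    (E : pe_bundle M) (rho : bundle_map E (TM M))
    (br : Gamma E -> Gamma E -> Gamma E) (Epre : pre_courant rho br)
    (C : pe_bundle M) (nabla : Gamma (TM M) -> Gamma C -> Gamma C)
    (metr : metric_connection nabla) :
  (exists! gamma0 : Gamma C -> Gamma C -> Gamma E,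
     is_gamma0 rho nabla gamma0) /\
  forall gamma0 : Gamma C -> Gamma C -> Gamma E, is_gamma0 rho nabla gamma0 ->
    let EC := pe_dsum E C in
    let rhoEC : bundle_map EC (TM M) := dsum_map C rho in
    let brEC : Gamma EC -> Gamma EC -> Gamma EC :=
      dsum_bracket rho br nabla gamma0 in
    [/\ forall e1 e2 : Gamma E,
          brEC (sec_pair e1 0) (sec_pair e2 0) = sec_pair (br e1 e2) 0,
        forall (e : Gamma E) (c : Gamma C),
          brEC (sec_pair e 0) (sec_pair 0 c) =
            sec_pair 0 (nabla (bmap_sec rho e) c) /\
          brEC (sec_pair 0 c) (sec_pair e 0) =
            - sec_pair 0 (nabla (bmap_sec rho e) c),
        forall c1 c2 : Gamma C,
          brEC (sec_pair 0 c1) (sec_pair 0 c2) = - sec_pair (gamma0 c1 c2) 0,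
        pre_courant rhoEC brEC &
        courant rho br ->
          [/\ flat nabla -> courant rhoEC brEC,
              courant rhoEC brEC <-> flat_along nabla (range (bmap_sec rho)) &
              range (bmap_sec rho) = setT ->
                (courant rhoEC brEC <-> flat nabla)]].
Proof.
have [_ skew _ _] := Epre; have conn := proj1 metr.
split=> [|gamma0 g0 EC rhoEC brEC]; first exact: gamma0_unique.
have g00 := gamma0_0l metr g0; have g0r := gamma0_0r metr g0.
split=> [e1 e2|e c|c1 c2||Ec].
- apply: secP; rewrite ?(dsum_br_fst, dsum_br_snd) !sec_fst_pair !sec_snd_pair.
    by rewrite g00 subr0.
  by rewrite !(nabla0 conn) subrr.
- split; apply: secP; rewrite ?(sec_fstN, sec_sndN);
    rewrite ?(dsum_br_fst, dsum_br_snd) !sec_fst_pair !sec_snd_pair.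
  + by rewrite (br0r skew) g00 subrr.
  + by rewrite (nabla0 conn) subr0.
  + by rewrite (br0l skew) g0r subrr oppr0.
  + by rewrite (nabla0 conn) sub0r.
- apply: secP; rewrite ?(sec_fstN, sec_sndN);
    rewrite ?(dsum_br_fst, dsum_br_snd) !sec_fst_pair !sec_snd_pair.
    by rewrite (br0l skew) sub0r.
  by rewrite bmap_sec0 !(nabla0l conn) subrr oppr0.
- exact: dsum_pre_courant.
- have flatE := dsum_courant metr g0 Epre Ec; split=> [fl||rhoT].
  + by apply/flatE => X Y c _ _; exact: fl.
  + exact: flatE.
  + by rewrite /flat -rhoT.
Qed.
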